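(* Let $(a_n)_{\mathrm c}=[a_{n\varepsilon}]_{\mathrm c}\in\widetilde{\mathbb C}_{\mathrm c}$, $c=[c_\varepsilon]\in\widetilde{\mathbb C}$, and let $U$ be the interior, in the sharp topology, of $S((a_n)_{\mathrm c},c)$. For $z=[z_\varepsilon]\in U$ set $$f(z):=\sum_{n\in\widetilde{\mathbb N}}a_n(z-c)^n=\Big[\sum_{n=0}^{\infty}a_{n\varepsilon}(z_\varepsilon-c_\varepsilon)^n\Big]=:[v_\varepsilon(z_\varepsilon)].$$ Then $f$ is a generalized holomorphic function on $U$, $f\in\mathcal{GH}(U)$, defined by the net $(v_\varepsilon)$.
   Context: Fix $I=(0,1]$ and a gauge $\rho=(\rho_\varepsilon)_{\varepsilon\in I}$ with $\rho_\varepsilon\in I$ and $\rho_\varepsilon\to0$ as $\varepsilon\to0$. ''$\forall^0\varepsilon$'' means ''for all sufficiently small $\varepsilon\in I$''. A net $(x_\varepsilon)\in\mathbb C^I$ is $\rho$-moderate ($(x_\varepsilon)\in\mathbb C_\rho$) if $\exists N\in\mathbb N\,\forall^0\varepsilon:|x_\varepsilon|\le\rho_\varepsilon^{-N}$, and $\rho$-negligible if $\forall q\in\mathbb N\,\forall^0\varepsilon:|x_\varepsilon|\le\rho_\varepsilon^q$. $\widetilde{\mathbb C}:=\mathbb C_\rho/\{\text{negligible nets}\}$ with classes $[x_\varepsilon]$; $\widetilde{\mathbb R}\subseteq\widetilde{\mathbb C}$ consists of classes of real moderate nets; $\mathrm d\rho:=[\rho_\varepsilon]$, $|[z_\varepsilon]|:=[|z_\varepsilon|]$.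 On $\widetilde{\mathbb R}$: $[x_\varepsilon]\le[y_\varepsilon]$ iff $x_\varepsilon\le y_\varepsilon+z_\varepsilon$ $\forall^0\varepsilon$ for some negligible $(z_\varepsilon)$; $x<y$ iff $\exists m\,\forall^0\varepsilon:y_\varepsilon-x_\varepsilon>\rho_\varepsilon^m$; $\widetilde{\mathbb R}_{>0}:=\{x:x>0\}$. The sharp topology on $\widetilde{\mathbb C}$ is generated by $B_r(c):=\{z:|z-c|<r\}$, $r\in\widetilde{\mathbb R}_{>0}$. Hypernatural numbers: $\widetilde{\mathbb N}:=\{[n_\varepsilon]\in\widetilde{\mathbb R}:n_\varepsilon\in\mathbb N\ \forall\varepsilon\}$; for each $N\in\widetilde{\mathbb N}$ a representative $(\mathrm{ni}(N)_\varepsilon)$ with all $\mathrm{ni}(N)_\varepsilon\in\mathbb N$ is fixed. Hyperlimit: $l=\lim_{n\in\widetilde{\mathbb N}}a_n$ means $\forall q\,\exists M\in\widetilde{\mathbb N}\,\forall n\in\widetilde{\mathbb N}:n\ge M\Rightarrow|a_n-l|<\mathrm d\rho^q$. Hyperseries: a net $(a_{n\varepsilon})_{n\in\mathbb N,\varepsilon\in I}$ is moderate over hypersums if for every $N\in\widetilde{\mathbb N}$ the net $(\sum_{n=0}^{\mathrm{ni}(N)_\varepsilon}a_{n\varepsilon})_\varepsilon$ is $\rho$-moderate; two such nets are equivalent if for all $N,M\in\widetilde{\mathbb N}$ the net $(\sum_{n=\mathrm{ni}(N)_\varepsilon}^{\mathrm{ni}(M)_\varepsilon}(a_{n\varepsilon}-\bar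 a_{n\varepsilon}))_\varepsilon$ is negligible; the quotient is $\widetilde{\mathbb C}_{\mathrm s}$ with classes $[b_{n\varepsilon}]_{\mathrm s}$. $\sum_{n=N}^Mb_n:=[\sum_{n=\mathrm{ni}(N)_\varepsilon}^{\mathrm{ni}(M)_\varepsilon}b_{n\varepsilon}]$, and $\sum_{n\in\widetilde{\mathbb N}}b_n:=\lim_{N\in\widetilde{\mathbb N}}\sum_{n=0}^Nb_n$ when this exists. Coefficients: $\widetilde{\mathbb C}_{\mathrm c}$ is the set of weakly $\rho$-moderate nets $(a_{n\varepsilon})$ ($\exists Q,R\in\mathbb N\,\forall^0\varepsilon\,\forall n\in\mathbb N:|a_{n\varepsilon}|\le\rho_\varepsilon^{-nQ-R}$) modulo strong equivalence ($\forall q,r\,\forall^0\varepsilon\,\forall n:|a_{n\varepsilon}-\bar a_{n\varepsilon}|\le\rho_\varepsilon^{nq+r}$), classes $(a_n)_{\mathrm c}=[a_{n\varepsilon}]_{\mathrm c}$. $\widetilde{\mathbb R}_\infty:=(\mathbb R\cup\{\pm\infty\})^I/\sim_\rho$, and for $x\in\widetilde{\mathbb R}$, $y\in\widetilde{\mathbb R}_\infty$, $x<y$ iff $\exists m\,\forall^0\varepsilon:y_\varepsilon>x_\varepsilon+\rho_\varepsilon^m$. Radius: $\mathrm{rad}(a_n)_{\mathrm c}:=[(\limsup_n|a_{n\varepsilon}|^{1/n})^{-1}]\in\widetilde{\mathbb R}_\infty$. Set of convergence: $S((a_n)_{\mathrm c},c)$ is the set of $z\in\widetilde{\mathbb C}$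 with $|z-c|<\mathrm{rad}(a_n)_{\mathrm c}$ for which there exist representatives $z=[z_\varepsilon]$, $c=[c_\varepsilon]$, $(a_n)_{\mathrm c}=[a_{n\varepsilon}]_{\mathrm c}$ such that: (a) the net $(a_{n\varepsilon}(z_\varepsilon-c_\varepsilon)^n)_{n,\varepsilon}$ is moderate over hypersums; (b) $\sum_{n\in\widetilde{\mathbb N}}a_n(z-c)^n$ converges and equals $[\sum_{n=0}^{\infty}a_{n\varepsilon}(z_\varepsilon-c_\varepsilon)^n]$; (c) for every representative $z=[\hat z_\varepsilon]$, the net $(\sum_{n\ge1}na_{n\varepsilon}(\hat z_\varepsilon-c_\varepsilon)^{n-1})_\varepsilon$ is $\rho$-moderate (these conditions hold for any representatives once they hold for some). Generalized holomorphic functions: for $U\subseteq\widetilde{\mathbb C}$ sharply open, $f:U\to\widetilde{\mathbb C}$ is a GHF, $f\in\mathcal{GH}(U)$, if there exist open sets $\Omega_\varepsilon\subseteq\mathbb C$ and holomorphic $f_\varepsilon:\Omega_\varepsilon\to\mathbb C$ such that for every $z\in U$ and every representative $z=[z_\varepsilon]$: $z_\varepsilon\in\Omega_\varepsilon$ $\forall^0\varepsilon$, $f(z)=[f_\varepsilon(z_\varepsilon)]$, and $(f_\varepsilon^{(k)}(z_\varepsilon))\in\mathbb C_\rho$ for all $k\in\mathbb N$; $f$ is then said to be defined by $(f_\varepsilon)$. *)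

(* Defs.v *)
From Stdlib Require Import Reals List ClassicalEpsilon.
From Coquelicot Require Import Coquelicot.
Open Scope R_scope.

(* Nets are functions R -> _, only the values at eps in I = (0,1] matter. *)

Definition gauge (rho : R -> R) : Prop :=
  (forall e, 0 < e <= 1 -> 0 < rho e <= 1) /\
  (forall d, 0 < d -> exists e0, 0 < e0 <= 1 /\ forall e, 0 < e <= e0 -> rho e < d).

Definition ev (P : R -> Prop) : Prop :=
  exists e0, 0 < e0 <= 1 /\ forall e, 0 < e <= e0 -> P e.

Section GenNum.
Variable rho : R -> R.

Definition Rmoderate (x : R -> R) : Prop :=
  exists N : nat, ev (fun e => Rabs (x e) <= / (rho e ^ N)).
Definition Cmoderate (x : R -> C) : Prop :=
  exists N : nat, ev (fun e => Cmod (x e) <= / (rho e ^ N)).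
Definition Cnegligible (x : R -> C) : Prop :=
  forall q : nat, ev (fun e => Cmod (x e) <= rho e ^ q).
Definition Rnegligible (x : R -> R) : Prop :=
  forall q : nat, ev (fun e => Rabs (x e) <= rho e ^ q).

(* equality in C~ of the classes of two (moderate) nets *)
Definition Cequiv (x y : R -> C) : Prop := Cnegligible (fun e => minus (x e) (y e)).

Definition Rt_le (x y : R -> R) : Prop :=
  exists z, Rnegligible z /\ ev (fun e => x e <= y e + z e).
Definition Rt_lt (x y : R -> R) : Prop :=
  exists m : nat, ev (fun e => y e - x e > rho e ^ m).
Definition Rt_pos (r : R -> R) : Prop := Rmoderate r /\ Rt_lt (fun _ => 0) r.

Definition Cabs_net (x : R -> C) : R -> R := fun e => Cmod (x e).

Definition in_ball (cr : (R -> C) * (R -> R)) (z : R -> C) : Prop :=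
  Cmoderate z /\ Rt_lt (Cabs_net (fun e => minus (z e) (fst cr e))) (snd cr).

(* Interior, in the sharp topology (generated by the balls, i.e. whose open
   sets are unions of finite intersections of balls), of a set S of
   generalized complex numbers (given as a predicate on representatives). *)
Definition sharp_interior (S : (R -> C) -> Prop) (z : R -> C) : Prop :=
  Cmoderate z /\
  exists l : list ((R -> C) * (R -> R)),
    (forall p, In p l -> Cmoderate (fst p) /\ Rt_pos (snd p)) /\
    (forall p, In p l -> in_ball p z) /\
    (forall w, Cmoderate w -> (forall p, In p l -> in_ball p w) -> S w).

(* Hypernatural numbers, given by natural-valued representatives. *)
Definition hnat (n : R -> nat) : Prop := Rmoderate (fun e => INR (n e)).

Definition hypersum (b : nat -> R -> C) (N : R -> nat) : R -> C :=
  fun e => sum_n (fun n => b n e) (N e).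

Definition mod_hypersums (b : nat -> R -> C) : Prop :=
  forall N, hnat N -> Cmoderate (hypersum b N).

Definition hyperseries_is (b : nat -> R -> C) (l : R -> C) : Prop :=
  forall q : nat, exists M, hnat M /\
    forall N, hnat N -> Rt_le (fun e => INR (M e)) (fun e => INR (N e)) ->
      Rt_lt (Cabs_net (fun e => minus (hypersum b N e) (l e))) (fun e => rho e ^ q).

Definition weakly_moderate (a : nat -> R -> C) : Prop :=
  exists Q R0 : nat, ev (fun e => forall n : nat, Cmod (a n e) <= / (rho e ^ (n * Q + R0))).
Definition strong_equiv (a a' : nat -> R -> C) : Prop :=
  forall q r : nat, ev (fun e => forall n : nat,
    Cmod (minus (a n e) (a' n e)) <= rho e ^ (n * q + r)).

Definition Rt_lt_inf (x : R -> R) (y : R -> Rbar) : Prop :=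
  exists m : nat, ev (fun e => Rbar_lt (x e + rho e ^ m) (y e)).

End GenNum.

Definition Cseries (b : nat -> C) : C :=
  epsilon (inhabits (RtoC 0)) (fun l => is_series b l).


Definition nroot (x : R) (n : nat) : R :=
  if Req_EM_T x 0 then 0 else Rpower x (/ INR n).

Definition Rbar_inv_rad (l : Rbar) : Rbar :=
  match l with
  | Finite r => if Req_EM_T r 0 then p_infty else Finite (/ r)
  | p_infty => Finite 0
  | m_infty => p_infty
  end.

Definition rad_net (a : nat -> R -> C) : R -> Rbar :=
  fun e => Rbar_inv_rad (LimSup_seq (fun n => nroot (Cmod (a n e)) n)).

Definition conv_set (rho : R -> R) (a : nat -> R -> C) (c : R -> C) (z : R -> C) : Prop :=
  Cmoderate rho z /\
  Rt_lt_inf rho (Cabs_net (fun e => minus (z e) (c e))) (rad_net a) /\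
  exists (z' c' : R -> C) (a' : nat -> R -> C),
    Cequiv rho z z' /\ Cequiv rho c c' /\ strong_equiv rho a a' /\
    mod_hypersums rho (fun n e => mult (a' n e) (Cpow (minus (z' e) (c' e)) n)) /\
    hyperseries_is rho (fun n e => mult (a' n e) (Cpow (minus (z' e) (c' e)) n))
      (fun e => Cseries (fun n => mult (a' n e) (Cpow (minus (z' e) (c' e)) n))) /\
    (forall zh, Cequiv rho z zh ->
       Cmoderate rho (fun e => Cseries (fun n =>
          mult (RtoC (INR n)) (mult (a' n e) (Cpow (minus (zh e) (c' e)) (n - 1)))))).

(* f : U -> C~ is a generalized holomorphic function defined by the net (fe).
   [fval z l] means f(z) = [l]. The k-th derivatives of fe_eps on Omega_eps
   are given by D eps k. *)
Definition GH_defined_by (rho : R -> R) (U : (R -> C) -> Prop)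
  (fval : (R -> C) -> (R -> C) -> Prop) (fe : R -> C -> C) : Prop :=
  exists (Omega : R -> C -> Prop) (D : R -> nat -> C -> C),
    (forall e, 0 < e <= 1 -> open (Omega e)) /\
    (forall e, 0 < e <= 1 -> forall w, Omega e w -> D e 0%nat w = fe e w) /\
    (forall e, 0 < e <= 1 -> forall (k : nat) w, Omega e w ->
        @is_derive C_AbsRing C_NormedModule (D e k) w (D e (S k) w)) /\
    (forall z, U z -> forall z', Cequiv rho z z' ->
        ev (fun e => Omega e (z' e)) /\
        fval z (fun e => fe e (z' e)) /\
        (forall k : nat, Cmoderate rho (fun e => D e k (z' e)))).

(* Main.v *)
(* For each eps, v_eps is a power series, holomorphic on its disk of convergence, so only moderateness of the
   derivatives and independence of representatives are at stake. A change of representatives of z and c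
   moves the sum negligibly by the mean value inequality and condition (c). It moves the hypersums
   negligibly because moderateness over hypersums bounds the terms a_n u^n uniformly for n <= rho^-K, and
   this bound survives replacing |u| by max(|u|, rho^(Q+1)) and then by a negligibly larger radius.
   Hence v is moderate at every representative of every point of the interior. If z + h ranges over a
   circle of radius rho^r inside the interior, Cauchy's estimate picks an h_eps with
   rho^r |v^(k+1)(z)| <= 2 |v^(k)(z + h_eps)|, and z + h_eps again represents an interior point, so
   moderateness propagates from v^(k) to v^(k+1). *)
Require Import Defs.
From Stdlib Require Import Reals List ClassicalEpsilon Lra Lia.
From Coquelicot Require Import Coquelicot.
Open Scope R_scope.

(* [sum_Sn] and friends leave equations in [AbelianMonoid.sort], which [ring] does not recognize. *)
Ltac Cring := lazymatch goal with |- ?x = ?y => change (@eq C x y) end; ring.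

(** * Complex power series *)

(** Once some limit exists, the value picked by [epsilon] is a limit too, and limits in the complex
    plane are unique. *)
Lemma Cseries_unique (b : nat -> C) (l : C) :
  is_series (V := C_NormedModule) b l -> Cseries b = l.
Proof.
  intros H. unfold Cseries.
  pose proof (epsilon_spec (inhabits (RtoC 0))
    (fun l : C => is_series (V := C_NormedModule) b l) (ex_intro _ l H)) as H'.
  exact (filterlim_locally_unique (V := C_NormedModule) _ _ _ H' H).
Qed.

Lemma Cseries_correct (b : nat -> C) :
  ex_series (V := C_NormedModule) b -> is_series (V := C_NormedModule) b (Cseries b).
Proof. intros [l H]. rewrite (Cseries_unique _ _ H). exact H. Qed.

Lemma Cmod_sum_n_le (b : nat -> C) (n : nat) :
  Cmod (sum_n (G := C_AbelianMonoid) b n) <= sum_n (fun k => Cmod (b k)) n.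
Proof.
  induction n as [|n IH].
  - rewrite !sum_O. apply Rle_refl.
  - rewrite !sum_Sn. eapply Rle_trans; [apply Cmod_triangle|].
    apply Rplus_le_compat_r, IH.
Qed.

Lemma ex_Cseries_Cmod (b : nat -> C) :
  ex_series (fun n => Cmod (b n)) -> ex_series (V := C_NormedModule) b.
Proof.
  apply (ex_series_le (V := C_CompleteNormedModule)).
  intros n. apply Rle_refl.
Qed.

Lemma Cmod_is_series_le (b : nat -> C) (l : C) (b' : nat -> R) (L : R) :
  is_series (V := C_NormedModule) b l -> is_series b' L ->
  (forall n, Cmod (b n) <= b' n) -> Cmod l <= L.
Proof.
  intros Hb HL Hle.
  apply (filterlim_le (F := eventually)
    (fun n => Cmod (sum_n (G := C_AbelianMonoid) b n)) (sum_n b') (Cmod l) L).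
  - exists 0%nat. intros n _.
    eapply Rle_trans; [apply Cmod_sum_n_le|]. apply sum_n_m_le, Hle.
  - eapply filterlim_comp; [exact Hb | apply (filterlim_norm (V := C_NormedModule))].
  - exact HL.
Qed.

Lemma Cmod_minus_sym (x y : C) : Cmod (x - y) = Cmod (y - x).
Proof. rewrite <- Cmod_opp. f_equal. ring. Qed.

Lemma Cmod_triangle3 (x y z : C) : Cmod (x - z) <= Cmod (x - y) + Cmod (y - z).
Proof. replace (x - z)%C with ((x - y) + (y - z))%C by ring. apply Cmod_triangle. Qed.

Lemma Cmod_minus_le (x y : C) : Cmod x <= Cmod y + Cmod (x - y).
Proof. replace x with (y + (x - y))%C at 1 by ring. apply Cmod_triangle. Qed.

(** * Power series, formal derivatives and termwise differentiation *)

Definition cpseries (b : nat -> C) (u : C) : C := Cseries (fun n => mult (b n) (Cpow u n)).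
Definition cderiv (b : nat -> C) : nat -> C := fun n => Cmult (RtoC (INR (S n))) (b (S n)).
(** Taken from the real series of moduli, so that the theory of [CV_radius] applies. It is the usual
    radius, since a complex power series converges absolutely inside its disk. *)
Definition cradius (b : nat -> C) : Rbar := CV_radius (fun n => Cmod (b n)).

Lemma cradius_summable (b : nat -> C) (s : R) :
  0 <= s -> Rbar_lt s (cradius b) -> ex_series (fun n => Cmod (b n) * s ^ n).
Proof.
  intros Hs H. apply ex_series_ext with (fun n => Rabs (Cmod (b n) * s ^ n)).
  - intros n. apply Rabs_pos_eq, Rmult_le_pos; [apply Cmod_ge_0 | apply pow_le, Hs].
  - apply CV_disk_inside. rewrite Rabs_pos_eq; assumption.
Qed.

Lemma summable_le_cradius (b : nat -> C) (s : R) :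
  0 <= s -> ex_series (fun n => Cmod (b n) * s ^ n) -> Rbar_le s (cradius b).
Proof.
  intros Hs H. apply Lub_Rbar_correct. unfold CV_disk.
  apply ex_series_ext with (2 := H). intros n. symmetry.
  apply Rabs_pos_eq, Rmult_le_pos; [apply Cmod_ge_0 | apply pow_le, Hs].
Qed.

Lemma cradius_between (b : nat -> C) (x : R) :
  Rbar_lt x (cradius b) -> exists s, x < s /\ Rbar_lt s (cradius b).
Proof.
  destruct (cradius b) as [r| |]; simpl; intros H.
  - exists ((x + r) / 2). lra.
  - exists (x + 1). split; [lra | exact I].
  - contradiction.
Qed.

Lemma cradius_cderiv (b : nat -> C) : cradius (cderiv b) = cradius b.
Proof.
  unfold cradius. rewrite <- (CV_radius_derive (fun n => Cmod (b n))).
  apply CV_radius_ext. intros n. unfold cderiv, PS_derive.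
  rewrite Cmod_mult, Cmod_R, Rabs_pos_eq; [reflexivity | apply pos_INR].
Qed.

Lemma cpseries_is_series (b : nat -> C) (u : C) :
  Rbar_lt (Cmod u) (cradius b) ->
  is_series (V := C_NormedModule) (fun n => Cmult (b n) (Cpow u n)) (cpseries b u).
Proof.
  intros H. apply Cseries_correct, ex_Cseries_Cmod.
  apply ex_series_ext with (2 := cradius_summable _ _ (Cmod_ge_0 u) H).
  intros n. rewrite Cmod_mult, Cmod_pow. reflexivity.
Qed.

(** Writing E_n for the remainder at exponent n + 2, the induction rests on E_(n+1) = (u + h) E_n +
    (n + 2) h^2 u^(n+1). The bound is shaped like a term of the second derivative of the series of
    moduli. *)
Lemma Cpow_taylor1 (u h : C) (s : R) (n : nat) :
  Cmod u <= s -> Cmod (u + h)%C <= s ->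
  Cmod ((u + h) ^ S (S n) - u ^ S (S n) - RtoC (INR (S (S n))) * h * u ^ S n)%C
   <= Cmod h ^ 2 * (INR (S n) * INR (S (S n)) * s ^ n).
Proof.
  intros Hu Huh.
  assert (Hs : 0 <= s) by (eapply Rle_trans; [apply Cmod_ge_0 | exact Hu]).
  induction n as [|n IH].
  - replace ((u + h) ^ 2 - u ^ 2 - RtoC (INR 2) * h * u ^ 1)%C with (h ^ 2)%C.
    + rewrite Cmod_pow. simpl. pose proof (pow2_ge_0 (Cmod h)). simpl in H. lra.
    + simpl. rewrite RtoC_plus. ring.
  - set (E := ((u + h) ^ S (S n) - u ^ S (S n) - RtoC (INR (S (S n))) * h * u ^ S n)%C) in *.
    replace ((u + h) ^ S (S (S n)) - u ^ S (S (S n)) - RtoC (INR (S (S (S n)))) * h * u ^ S (S n))%C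
      with ((u + h) * E + RtoC (INR (S (S n))) * h ^ 2 * u ^ S n)%C.
    2:{ unfold E. rewrite (S_INR (S (S n))), RtoC_plus. simpl Cpow. ring. }
    eapply Rle_trans; [apply Cmod_triangle|].
    rewrite !Cmod_mult, !Cmod_pow, Cmod_R, Rabs_pos_eq by apply pos_INR.
    set (H2 := Cmod h ^ 2) in *.
    assert (HH2 : 0 <= H2) by apply pow2_ge_0.
    apply Rle_trans with (s * (H2 * (INR (S n) * INR (S (S n)) * s ^ n)) + INR (S (S n)) * H2 * s ^ S n).
    + apply Rplus_le_compat.
      * apply Rmult_le_compat; try apply Cmod_ge_0; assumption.
      * apply Rmult_le_compat_l; [apply Rmult_le_pos; [apply pos_INR | assumption]|].
        apply pow_incr. split; [apply Cmod_ge_0 | assumption].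
    + rewrite !(S_INR (S n)), !S_INR. simpl pow.
      assert (0 <= H2 * (s * s ^ n)) by (apply Rmult_le_pos; [assumption|]; apply Rmult_le_pos; [assumption | apply pow_le, Hs]).
      pose proof (pos_INR n). nra.
Qed.

(** The termwise remainders sum up to |h|^2 times the second derivative of the series of moduli at
    [s]. That value is finite because differentiation keeps the radius. *)
Lemma cpseries_taylor1 (b : nat -> C) (s : R) :
  Rbar_lt s (cradius b) ->
  exists K, 0 <= K /\ forall u h, Cmod u <= s -> Cmod (u + h)%C <= s ->
    Cmod (cpseries b (u + h) - cpseries b u - h * cpseries (cderiv b) u)%C <= Cmod h ^ 2 * K.
Proof.
  intros Hs.
  destruct (Rlt_or_le s 0) as [Hneg|Hpos].
  { exists 0. split; [lra|]. intros u h Hu. pose proof (Cmod_ge_0 u). lra. }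
  assert (Hs2 : ex_series (fun n => Cmod (cderiv (cderiv b) n) * s ^ n)).
  { apply cradius_summable; [exact Hpos|]. now rewrite !cradius_cderiv. }
  exists (Series (fun n => Cmod (cderiv (cderiv b) n) * s ^ n)). split.
  { rewrite <- (Rmult_0_l (Series (fun n => Cmod (cderiv (cderiv b) n) * s ^ n))).
    rewrite <- Series_scal_l. apply Series_le; [|exact Hs2]. intros n.
    rewrite Rmult_0_l. split; [lra | apply Rmult_le_pos; [apply Cmod_ge_0 | apply pow_le, Hpos]]. }
  intros u h Hu Huh.
  assert (Hlt : forall x : C, Cmod x <= s -> Rbar_lt (Cmod x) (cradius b)).
  { intros x Hx. eapply Rbar_le_lt_trans; [|exact Hs]. exact Hx. }
  pose proof (cpseries_is_series b _ (Hlt _ Huh)) as S1.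
  pose proof (cpseries_is_series b _ (Hlt _ Hu)) as S0.
  assert (S' := cpseries_is_series (cderiv b) u). rewrite cradius_cderiv in S'.
  specialize (S' (Hlt _ Hu)).
  pose proof (is_series_minus (V := C_NormedModule) _ _ _ _ S1 S0) as S2.
  set (d0 := fun n : nat => _) in S2.
  (* The terms of index 0 cancel here, and those of index 1 in [S5]. Each shift drops a zero term,
     so that the remaining series starts at exponent 2. *)
  assert (S3 : is_series (V := C_NormedModule) (fun n => d0 (S n)) (cpseries b (u + h) - cpseries b u)%C).
  { apply is_series_incr_1.
    replace (plus _ (d0 0%nat)) with (cpseries b (u + h) - cpseries b u)%C; [exact S2|].
    unfold d0. change plus with Cplus. change opp with Copp. simpl. ring. }
  pose proof (is_series_minus (V := C_NormedModule) _ _ _ _ S3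
    (is_series_scal_l (V := C_NormedModule) h _ _ S')) as S4.
  set (d1 := fun n : nat => _) in S4.
  assert (S5 : is_series (V := C_NormedModule) (fun n => d1 (S n))
     (cpseries b (u + h) - cpseries b u - h * cpseries (cderiv b) u)%C).
  { apply is_series_incr_1.
    replace (plus _ (d1 0%nat)) with (cpseries b (u + h) - cpseries b u - h * cpseries (cderiv b) u)%C; [exact S4|].
    unfold d1, d0, cderiv. change plus with Cplus. change opp with Copp. change scal with Cmult.
    simpl. ring. }
  eapply Cmod_is_series_le; [exact S5 | apply (is_series_scal_l (V := R_NormedModule)), Series_correct, Hs2|].
  intros n. cbv beta.
  replace (d1 (S n)) with (b (S (S n)) * ((u + h) ^ S (S n) - u ^ S (S n) - RtoC (INR (S (S n))) * h * u ^ S n))%C.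
  2:{ unfold d1, d0, cderiv. change plus with Cplus. change opp with Copp. change scal with Cmult.
      ring. }
  rewrite Cmod_mult. unfold cderiv. rewrite !Cmod_mult, !Cmod_R, !Rabs_pos_eq by apply pos_INR.
  change scal with Rmult.
  eapply Rle_trans; [apply Rmult_le_compat_l, (Cpow_taylor1 u h s n Hu Huh); apply Cmod_ge_0|].
  right. ring.
Qed.

Lemma is_derive_of_quadratic_remainder (f : C -> C) (x l : C) (d K : R) :
  0 < d -> 0 <= K ->
  (forall h, Cmod h < d -> Cmod (f (x + h) - f x - h * l)%C <= Cmod h ^ 2 * K) ->
  @is_derive C_AbsRing C_NormedModule f x l.
Proof.
  intros Hd HK H. split.
  { apply is_linear_scal_l. }
  intros y Hy. apply (is_filter_lim_locally_unique (V := AbsRing_NormedModule C_AbsRing)) in Hy. subst y.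
  intros eps.
  (* Dividing by K + 1 keeps the quotient meaningful when K = 0. *)
  assert (Hr : 0 < Rmin d (eps / (K + 1))).
  { apply Rmin_glb_lt; [exact Hd|]. apply Rdiv_lt_0_compat; [apply cond_pos | lra]. }
  exists (mkposreal _ Hr). intros y Hy.
  change (Cmod (y - x)%C < Rmin d (eps / (K + 1))) in Hy.
  change (Cmod (f y - f x - (y - x) * l)%C <= eps * Cmod (y - x)%C).
  set (h := (y - x)%C) in *.
  replace (f y) with (f (x + h)%C) by (f_equal; unfold h; ring).
  eapply Rle_trans; [apply H; eapply Rlt_le_trans; [exact Hy | apply Rmin_l]|].
  assert (Hh : Cmod h * (K + 1) < eps).
  { apply Rlt_div_r; [lra|]. eapply Rlt_le_trans; [exact Hy | apply Rmin_r]. }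
  pose proof (Cmod_ge_0 h). nra.
Qed.

Lemma is_derive_cpseries (b : nat -> C) (c w : C) :
  Rbar_lt (Cmod (w - c)%C) (cradius b) ->
  @is_derive C_AbsRing C_NormedModule (fun w => cpseries b (w - c)%C) w (cpseries (cderiv b) (w - c)%C).
Proof.
  intros H. destruct (cradius_between _ _ H) as [s [Hs1 Hs2]].
  destruct (cpseries_taylor1 b s Hs2) as [K [HK HT]].
  apply (is_derive_of_quadratic_remainder _ _ _ (s - Cmod (w - c)%C) K); [lra | exact HK|].
  intros h Hh. replace (w + h - c)%C with (w - c + h)%C by ring.
  apply HT; [lra|]. eapply Rle_trans; [apply Cmod_triangle | lra].
Qed.

(** The point [x] lies on the segment from [v] to [u]. Its distance to [v] is recorded because, for
    nets, it makes [x] infinitely close to [v] when [u] is. *)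
Lemma cpseries_mean_value (b : nat -> C) (u v : C) :
  Rbar_lt (Cmod u) (cradius b) -> Rbar_lt (Cmod v) (cradius b) ->
  exists x, Cmod (x - v)%C <= Cmod (u - v)%C /\
    Cmod (cpseries b u - cpseries b v)%C <= Cmod (cpseries (cderiv b) x) * Cmod (u - v)%C.
Proof.
  intros Hu Hv.
  set (m := Rmax (Cmod u) (Cmod v)).
  assert (Hm : Rbar_lt m (cradius b)) by (unfold m, Rmax; destruct Rle_dec; assumption).
  destruct (cradius_between _ _ Hm) as [s [Hs1 Hs2]].
  destruct (cpseries_taylor1 b s Hs2) as [K [HK HT]].
  set (D := (cpseries b u - cpseries b v)%C).
  set (p := fun t : R => (v + RtoC t * (u - v))%C).
  assert (Hp : forall t, 0 <= t <= 1 -> Cmod (p t) <= m).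
  { intros t Ht. unfold p.
    replace (v + RtoC t * (u - v))%C with (RtoC t * u + RtoC (1 - t) * v)%C.
    2:{ rewrite RtoC_minus. ring. }
    eapply Rle_trans; [apply Cmod_triangle|].
    rewrite !Cmod_mult, !Cmod_R, !Rabs_pos_eq by lra.
    pose proof (Rmax_l (Cmod u) (Cmod v)). pose proof (Rmax_r (Cmod u) (Cmod v)).
    fold m in H, H0. nra. }
  (* Along the segment, apply the real mean value theorem to the projection of the series onto D. *)
  set (phi := fun t => Re (Cconj D * cpseries b (p t))%C).
  set (phi' := fun t => Re (Cconj D * (cpseries (cderiv b) (p t) * (u - v)))%C).
  assert (Hder : forall t, 0 <= t <= 1 -> derivable_pt_lim phi t (phi' t)).
  { intros t Ht eps Heps.
    set (W := Cmod (u - v)%C). assert (HW : 0 <= W) by apply Cmod_ge_0.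
    set (A := Cmod D * W ^ 2 * K).
    assert (HA : 0 <= A).
    { apply Rmult_le_pos; [apply Rmult_le_pos; [apply Cmod_ge_0 | apply pow_le, HW] | exact HK]. }
    assert (Hr : 0 < Rmin ((s - m) / (W + 1)) (eps / (A + 1))).
    { apply Rmin_glb_lt; apply Rdiv_lt_0_compat; lra. }
    exists (mkposreal _ Hr). intros h Hh0 Hh. simpl in Hh.
    assert (Hh1 : Rabs h * (W + 1) < s - m).
    { apply Rlt_div_r; [lra|]. eapply Rlt_le_trans; [exact Hh | apply Rmin_l]. }
    assert (Hh2 : Rabs h * (A + 1) < eps).
    { apply Rlt_div_r; [lra|]. eapply Rlt_le_trans; [exact Hh | apply Rmin_r]. }
    assert (Hh3 : 0 < Rabs h) by now apply Rabs_pos_lt.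
    replace ((phi (t + h) - phi t) / h - phi' t) with ((phi (t + h) - phi t - h * phi' t) / h) by now field.
    rewrite Rabs_div by exact Hh0.
    apply Rlt_div_l; [exact Hh3|].
    set (k := (RtoC h * (u - v))%C).
    assert (Hk : Cmod k = Rabs h * W) by (unfold k, W; now rewrite Cmod_mult, Cmod_R).
    replace (phi (t + h) - phi t - h * phi' t)
      with (Re (Cconj D * (cpseries b (p t + k) - cpseries b (p t) - k * cpseries (cderiv b) (p t)))%C).
    2:{ unfold phi, phi'. replace (p (t + h)) with (p t + k)%C.
        2:{ unfold p, k. rewrite RtoC_plus. ring. }
        unfold k, Re. simpl. ring. }
    eapply Rle_lt_trans; [apply re_le_Cmod|].
    rewrite Cmod_mult, Cmod_conj.
    eapply Rle_lt_trans.
    { apply Rmult_le_compat_l; [apply Cmod_ge_0|]. apply HT.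
      - eapply Rle_trans; [apply Hp, Ht | lra].
      - eapply Rle_trans; [apply Cmod_triangle|]. pose proof (Hp t Ht). rewrite Hk. nra. }
    rewrite Hk. replace (Cmod D * ((Rabs h * W) ^ 2 * K)) with (Rabs h * A * Rabs h) by (unfold A; ring).
    apply Rmult_lt_compat_r; [exact Hh3 | lra]. }
  destruct (MVT_cor2 phi phi' 0 1 Rlt_0_1 Hder) as [t [Ht Ht01]].
  exists (p t). split.
  { unfold p. replace (v + RtoC t * (u - v) - v)%C with (RtoC t * (u - v))%C by ring.
    rewrite Cmod_mult, Cmod_R, Rabs_pos_eq by lra. pose proof (Cmod_ge_0 (u - v)%C). nra. }
  (* The projection is chosen so that the increment of [phi] over the segment is exactly |D|^2. One
     factor |D| is then divided out, with D = 0 treated apart. *)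
  assert (HD : Cmod D ^ 2 = phi' t).
  { replace (phi' t) with (phi' t * (1 - 0)) by ring. rewrite <- Ht.
    unfold phi, p. replace (v + RtoC 1 * (u - v))%C with u by ring.
    replace (v + RtoC 0 * (u - v))%C with v by ring.
    apply RtoC_inj. rewrite Cmod2_conj.
    replace (Re (Cconj D * cpseries b u) - Re (Cconj D * cpseries b v)) with (Re (D * Cconj D)%C).
    2:{ unfold D, Re. simpl. ring. }
    unfold RtoC. apply injective_projections; simpl; unfold Re; simpl; ring. }
  assert (HD2 : Cmod D ^ 2 <= Cmod D * (Cmod (cpseries (cderiv b) (p t)) * Cmod (u - v)%C)).
  { rewrite HD. eapply Rle_trans; [apply Rle_abs|]. unfold phi'.
    eapply Rle_trans; [apply re_le_Cmod|]. rewrite !Cmod_mult, Cmod_conj. apply Rle_refl. }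
  pose proof (Cmod_ge_0 D) as [HDp | HD0].
  - simpl in HD2. rewrite Rmult_1_r in HD2. apply Rmult_le_reg_l in HD2; assumption.
  - rewrite <- HD0. apply Rmult_le_pos; apply Cmod_ge_0.
Qed.

(** * Radius of convergence *)

(** The index is a successor because the root of index 0 carries no information on [x]. *)
Lemma nroot_lt_pow (x y : R) (n : nat) :
  0 <= x -> nroot x (S n) < y -> x <= y ^ S n.
Proof.
  unfold nroot. intros Hx. destruct (Req_EM_T x 0) as [->|Hne]; intros Hy.
  - apply pow_le. lra.
  - assert (Hr : 0 < Rpower x (/ INR (S n))) by apply exp_pos.
    replace x with (Rpower x (/ INR (S n)) ^ S n).
    + apply pow_incr. lra.
    + rewrite <- Rpower_pow, Rpower_mult by exact Hr.
      rewrite Rinv_l by (apply not_0_INR; discriminate).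
      apply Rpower_1. lra.
Qed.

(** Any y strictly between the limit superior and 1/x will do: the midpoint if the limit superior is
    positive, and 1/(2x) if it is 0 or minus infinity. *)
Lemma lt_inv_LimSup (u : nat -> R) (x : R) :
  0 < x -> Rbar_lt x (Rbar_inv_rad (LimSup_seq u)) ->
  exists y N, 0 < y /\ y * x < 1 /\ forall n, (N <= n)%nat -> u n < y.
Proof.
  intros Hx.
  unfold LimSup_seq. destruct (ex_LimSup_seq u) as [[r| |] Hr]; cbn -[is_LimSup_seq]; simpl in Hr.
  - intros H. assert (Hy : exists y, 0 < y /\ r < y /\ y * x < 1).
    { destruct (Req_EM_T r 0) as [->|Hr0]; simpl in H.
      - exists (/ (2 * x)). assert (0 < / (2 * x)) by (apply Rinv_0_lt_compat; lra).
        repeat split; try assumption. replace (/ (2 * x) * x) with (/ 2) by (field; lra). lra.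
      - assert (Hr1 : 0 < r).
        { destruct (Rlt_or_le 0 r); [assumption|]. assert (/ r < 0) by (apply Rinv_lt_0_compat; lra). lra. }
        assert (Hrx : r * x < 1).
        { apply Rmult_lt_reg_l with (/ r); [apply Rinv_0_lt_compat; lra|].
          replace (/ r * (r * x)) with x by (field; lra). lra. }
        assert (Hix : r < / x).
        { apply Rmult_lt_reg_r with x; [lra|]. rewrite Rinv_l; lra. }
        exists ((r + / x) / 2). repeat split; try lra.
        replace ((r + / x) / 2 * x) with ((r * x + 1) / 2) by (field; lra). lra. }
    destruct Hy as [y [Hy0 [Hry Hyx]]].
    assert (Hp : 0 < y - r) by lra.
    destruct (proj2 (Hr (mkposreal _ Hp))) as [N HN].
    exists y, N. repeat split; try assumption.
    intros n Hn. specialize (HN n Hn). simpl in HN. lra.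
  - lra.
  - intros _. assert (Hy : 0 < / (2 * x)) by (apply Rinv_0_lt_compat; lra).
    destruct (Hr (/ (2 * x))) as [N HN]. exists (/ (2 * x)), N. repeat split; try assumption.
    replace (/ (2 * x) * x) with (/ 2) by (field; lra). lra.
Qed.

(** One half of the Cauchy-Hadamard formula: at some x' between [x] and the inverse limit superior,
    the terms are eventually dominated by a geometric series of ratio y x' < 1. *)
Lemma rad_net_le_cradius (a : nat -> R -> C) (e x : R) :
  0 <= x -> Rbar_lt x (rad_net a e) -> Rbar_lt x (cradius (fun n => a n e)).
Proof.
  intros Hx H. unfold rad_net in H. set (l := LimSup_seq _) in H.
  assert (Hx' : exists x' : R, x < x' /\ Rbar_lt x' (Rbar_inv_rad l)).
  { destruct (Rbar_inv_rad l) as [r| |]; simpl in *.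
    - exists ((x + r) / 2). lra.
    - exists (x + 1). split; [lra | exact I].
    - contradiction. }
  destruct Hx' as [x' [Hx1 Hx2]].
  eapply Rbar_lt_le_trans with x'; [exact Hx1|].
  destruct (lt_inv_LimSup _ x' ltac:(lra) Hx2) as [y [N [Hy [Hyx HN]]]].
  apply summable_le_cradius; [lra|].
  (* Dropping S N terms instead of N leaves only positive indices, as the bound on n-th roots
     requires. *)
  apply (ex_series_incr_n _ (S N)).
  apply (ex_series_le (V := R_CompleteNormedModule)) with (b := fun k => (y * x') ^ (S N + k)).
  - intros k. change (Rabs (Cmod (a (S N + k)%nat e) * x' ^ (S N + k)) <= (y * x') ^ (S N + k)).
    rewrite Rabs_pos_eq by (apply Rmult_le_pos; [apply Cmod_ge_0 | apply pow_le; lra]).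
    rewrite Rpow_mult_distr. apply Rmult_le_compat_r; [apply pow_le; lra|].
    apply nroot_lt_pow; [apply Cmod_ge_0|]. apply (HN (S N + k)%nat). lia.
  - apply (ex_series_incr_n (fun k => (y * x') ^ k) (S N)).
    apply ex_series_geom. rewrite Rabs_pos_eq; [exact Hyx | apply Rmult_le_pos; lra].
Qed.

(** * Cauchy's estimate *)

(** The root is exp(2 pi i / N). For 0 < m < N the real part of its m-th power is 1 - 2 sin^2(m pi /
    N), where the sine is positive, so the power is not 1. *)
Lemma primitive_root_of_unity (N : nat) :
  (0 < N)%nat ->
  exists w : C, Cmod w = 1 /\ Cpow w N = RtoC 1 /\
    forall m, (0 < m < N)%nat -> Cpow w m <> RtoC 1.
Proof.
  intros HN. assert (HN' : 0 < INR N) by now apply lt_0_INR.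
  set (t := 2 * PI / INR N).
  exists (cos t, sin t).
  assert (Hpow : forall m, Cpow (cos t, sin t) m = (cos (INR m * t), sin (INR m * t))).
  { induction m as [|m IH].
    - simpl. rewrite Rmult_0_l, cos_0, sin_0. reflexivity.
    - rewrite Cpow_S, IH, S_INR.
      replace ((INR m + 1) * t) with (t + INR m * t) by ring.
      rewrite cos_plus, sin_plus. unfold Cmult. simpl. f_equal; ring. }
  repeat split.
  - unfold Cmod. simpl fst. simpl snd. rewrite <- !Rsqr_pow2, Rplus_comm, sin2_cos2. apply sqrt_1.
  - rewrite Hpow. replace (INR N * t) with (2 * PI) by (unfold t; field; lra).
    rewrite cos_2PI, sin_2PI. reflexivity.
  - intros m [Hm0 Hm]. rewrite Hpow. intros H. apply (f_equal fst) in H. simpl in H.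
    apply lt_0_INR in Hm0. apply lt_INR in Hm.
    replace (INR m * t) with (2 * (INR m * PI / INR N)) in H by (unfold t; field; lra).
    rewrite cos_2a_sin in H.
    assert (0 < sin (INR m * PI / INR N)).
    { pose proof PI_RGT_0. apply sin_gt_0.
      - apply Rdiv_lt_0_compat; [nra | lra].
      - apply Rlt_div_l; nra. }
    nra.
Qed.

Lemma Csum_n_ext (f g : nat -> C) (n : nat) :
  (forall k, (k <= n)%nat -> f k = g k) ->
  sum_n (G := C_AbelianMonoid) f n = sum_n (G := C_AbelianMonoid) g n.
Proof. apply sum_n_ext_loc. Qed.

Lemma Csum_n_lin (x y : C) (f g : nat -> C) (n : nat) :
  sum_n (G := C_AbelianMonoid) (fun k => x * f k + y * g k)%C n =
  (x * sum_n (G := C_AbelianMonoid) f n + y * sum_n (G := C_AbelianMonoid) g n)%C.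
Proof.
  induction n as [|n IH]; [now rewrite !sum_O|].
  rewrite !sum_Sn, IH. change plus with Cplus. Cring.
Qed.

Lemma Csum_n_scal (x : C) (f : nat -> C) (n : nat) :
  sum_n (G := C_AbelianMonoid) (fun k => x * f k)%C n = (x * sum_n (G := C_AbelianMonoid) f n)%C.
Proof. apply (sum_n_mult_l (K := C_Ring)). Qed.

Lemma Csum_n_const (x : C) (n : nat) :
  sum_n (G := C_AbelianMonoid) (fun _ => x) n = (RtoC (INR (S n)) * x)%C.
Proof.
  induction n as [|n IH]; [rewrite sum_O; simpl; ring|].
  rewrite sum_Sn, IH, (S_INR (S n)), RtoC_plus. change plus with Cplus. Cring.
Qed.

Lemma Csum_n_le_max (f : nat -> C) (n : nat) :
  exists k, (k <= n)%nat /\ Cmod (sum_n (G := C_AbelianMonoid) f n) <= INR (S n) * Cmod (f k).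
Proof.
  induction n as [|n [k [Hk IH]]].
  - exists 0%nat. rewrite sum_O. split; [lia | simpl; lra].
  - rewrite sum_Sn, (S_INR (S n)). change plus with Cplus.
    assert (HS : 0 <= INR (S n)) by apply pos_INR.
    destruct (Rle_or_lt (Cmod (f k)) (Cmod (f (S n)))) as [H|H].
    + exists (S n). split; [lia|]. eapply Rle_trans; [apply Cmod_triangle | nra].
    + exists k. split; [lia|]. eapply Rle_trans; [apply Cmod_triangle | nra].
Qed.

(* The Cauchy integral over a circle is replaced by the average over N-th roots of unity, which is exact
   on polynomials of degree < N; the weight w^(j(N-1)) plays the role of the kernel w^(-j). *)
Section CauchyEstimate.
Variables (N : nat) (w u r : C).
Hypothesis N_ge_2 : (2 <= N)%nat.
Hypothesis wN : Cpow w N = RtoC 1.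
Hypothesis w_primitive : forall m, (0 < m < N)%nat -> Cpow w m <> RtoC 1.

Let A (n m : nat) : C :=
  sum_n (G := C_AbelianMonoid) (fun j => Cpow (u + r * Cpow w j) n * Cpow (Cpow w j) m)%C (pred N).

(** Splitting off one factor u + r w^j trades a power for a shift of the weight [m]. The recursion
    reduces every sum to geometric sums with n = 0. *)
Lemma root_average_S (n m : nat) : A (S n) m = (u * A n m + r * A n (S m))%C.
Proof.
  unfold A. rewrite <- Csum_n_lin. apply Csum_n_ext. intros j _. rewrite !Cpow_S. ring.
Qed.

(** With q = w^m, the geometric sum times q - 1 equals q^N - 1 = 0, and q is not 1 by
    primitivity. *)
Lemma root_average_0 (m : nat) : (0 < m < N)%nat -> A 0 m = RtoC 0.
Proof.
  intros Hm. unfold A. set (q := Cpow w m).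
  rewrite (Csum_n_ext _ (fun j => Cpow q j)).
  2:{ intros j _. unfold q. simpl. rewrite <- !Cpow_mult_r, (Nat.mul_comm j m). Cring. }
  assert (Hgeom : forall k, ((q - 1) * sum_n (G := C_AbelianMonoid) (fun j => Cpow q j) k = Cpow q (S k) - 1)%C).
  { induction k as [|k IH]; [rewrite sum_O; simpl; ring|].
    rewrite sum_Sn. change plus with Cplus. rewrite Cmult_plus_distr_l, IH. simpl. Cring. }
  specialize (Hgeom (pred N)). replace (S (pred N)) with N in Hgeom by lia.
  unfold q in Hgeom at 3. rewrite <- Cpow_mult_r, Nat.mul_comm, Cpow_mult_r, wN, Cpow_1_l in Hgeom.
  assert (Hq : (q - 1)%C <> RtoC 0).
  { intros H0. apply (w_primitive m Hm). fold q. replace q with ((q - 1) + 1)%C by ring.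
    rewrite H0. ring. }
  set (sg := sum_n _ _) in *.
  replace sg with (/ (q - 1) * ((q - 1) * sg))%C by (field; exact Hq).
  rewrite Hgeom. ring.
Qed.

(** Along the recursion the weights stay between m and m + n, hence strictly between 0 and N, where
    the geometric sums vanish. *)
Lemma root_average_low (n m : nat) : (0 < m)%nat -> (m + n < N)%nat -> A n m = RtoC 0.
Proof.
  revert m. induction n as [|n IH]; intros m Hm Hmn.
  - apply root_average_0. lia.
  - rewrite root_average_S, !IH by lia. ring.
Qed.

(** Weight N acts as weight 0 because w^N = 1. In the recursion, weight N + 1 acts as weight 1 and
    contributes nothing. *)
Lemma root_average_N (n : nat) : (n < N)%nat -> A n N = (RtoC (INR N) * Cpow u n)%C.
Proof.
  assert (HwN : forall j, Cpow (Cpow w j) N = RtoC 1).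
  { intros j. rewrite <- Cpow_mult_r, Nat.mul_comm, Cpow_mult_r, wN. apply Cpow_1_l. }
  induction n as [|n IH]; intros Hn.
  - unfold A. rewrite (Csum_n_ext _ (fun _ => RtoC 1)).
    2:{ intros j _. rewrite HwN. simpl. ring. }
    rewrite Csum_n_const. replace (S (pred N)) with N by lia. simpl. ring.
  - rewrite root_average_S, IH by lia.
    replace (A n (S N)) with (A n 1).
    2:{ unfold A. apply Csum_n_ext. intros j _. rewrite (Cpow_S _ N), HwN. simpl. ring. }
    rewrite root_average_low by lia. simpl. ring.
Qed.

(** Weight N - 1 acts as weight -1, so it extracts from (u + r w^j)^n the coefficient n r u^(n-1) of
    w^j. *)
Lemma root_average_pred (n : nat) :
  (n < N)%nat -> A n (pred N) = (RtoC (INR N) * r * (RtoC (INR n) * Cpow u (pred n)))%C.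
Proof.
  induction n as [|n IH]; intros Hn.
  - rewrite root_average_low by lia. simpl. ring.
  - rewrite root_average_S, IH by lia. replace (S (pred N)) with N by lia.
    rewrite root_average_N, S_INR, RtoC_plus by lia. destruct n; simpl; ring.
Qed.

Lemma root_average_poly (b : nat -> C) (K : nat) :
  (K < N)%nat ->
  sum_n (G := C_AbelianMonoid) (fun j =>
     sum_n (G := C_AbelianMonoid) (fun n => b n * Cpow (u + r * Cpow w j) n) K * Cpow (Cpow w j) (pred N))%C (pred N)
  = (RtoC (INR N) * r * sum_n (G := C_AbelianMonoid) (fun n => RtoC (INR n) * b n * Cpow u (pred n)) K)%C.
Proof.
  intros HK. rewrite <- Csum_n_scal.
  rewrite (Csum_n_ext _ (fun j => sum_n (G := C_AbelianMonoid) (fun n =>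
     Cpow (Cpow w j) (pred N) * (b n * Cpow (u + r * Cpow w j) n))%C K)).
  2:{ intros j _. rewrite Csum_n_scal. ring. }
  rewrite sum_n_switch. apply Csum_n_ext. intros n Hn.
  rewrite (Csum_n_ext _ (fun j => b n * (Cpow (u + r * Cpow w j) n * Cpow (Cpow w j) (pred N)))%C).
  2:{ intros j _. ring. }
  rewrite Csum_n_scal. fold (A n (pred N)). rewrite root_average_pred by lia. ring.
Qed.

End CauchyEstimate.

(** * From Cauchy's estimate for polynomials to power series *)

Definition cpartial (b : nat -> C) (u : C) (n : nat) : C :=
  sum_n (G := C_AbelianMonoid) (fun k => b k * Cpow u k)%C n.

Lemma cauchy_estimate_poly (b : nat -> C) (u : C) (r : R) (K : nat) :
  0 < r ->
  exists h, Cmod h = r /\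
    r * Cmod (cpartial (cderiv b) u K) <= Cmod (cpartial b (u + h) (S K)).
Proof.
  intros Hr. set (N := S (S K)).
  destruct (primitive_root_of_unity N) as [w [Hw1 [HwN Hw]]]; [unfold N; lia|].
  assert (Hw1' : forall j m, Cmod (Cpow (Cpow w j) m) = 1).
  { intros j m. rewrite !Cmod_pow, Hw1, !pow1. reflexivity. }
  pose proof (root_average_poly N w u (RtoC r) ltac:(unfold N; lia) HwN Hw b (S K) ltac:(unfold N; lia)) as H.
  (* The sum has N = K + 2 terms, more than the degree K + 1. It is at most N times its largest
     term, whose index j yields the point h = r w^j of the circle. *)
  match type of H with sum_n ?f ?n = _ => destruct (Csum_n_le_max f n) as [j [Hj Hle]] end.
  rewrite H in Hle. clear H.
  exists (RtoC r * Cpow w j)%C. split.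
  { rewrite Cmod_mult, Cmod_R, Cmod_pow, Hw1, pow1, Rabs_pos_eq; lra. }
  rewrite !Cmod_mult, !Cmod_R, Hw1', Rmult_1_r, !Rabs_pos_eq, Rmult_assoc in Hle; [|lra|apply pos_INR].
  replace (S (pred N)) with N in Hle by reflexivity.
  apply Rmult_le_reg_l in Hle; [|apply lt_0_INR; unfold N; lia].
  unfold cpartial. eapply Rle_trans; [|exact Hle].
  (* The term of index 0 of the differentiated polynomial vanishes, which accounts for the shift
     from S K to K. *)
  right. f_equal. f_equal. clear.
  induction K as [|K IH].
  - rewrite sum_Sn, !sum_O. change plus with Cplus. unfold cderiv. simpl. Cring.
  - rewrite sum_Sn, IH, (sum_Sn _ (S K)). change plus with Cplus. unfold cderiv.
    simpl pred. Cring.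
Qed.

(** The bound is uniform in [u] on the disk of radius [s]. Cauchy's estimate needs this, since its
    point [h] varies with the degree of the partial sum. *)
Lemma cpseries_tail (b : nat -> C) (s : R) (u : C) (n : nat) :
  Cmod u <= s -> Rbar_lt s (cradius b) ->
  Cmod (cpseries b u - cpartial b u n)%C
  <= Series (fun k => Cmod (b k) * s ^ k) - sum_n (fun k => Cmod (b k) * s ^ k) n.
Proof.
  intros Hu Hs.
  assert (Hs0 : 0 <= s) by (eapply Rle_trans; [apply Cmod_ge_0 | exact Hu]).
  assert (Hur : Rbar_lt (Cmod u) (cradius b)) by (apply (Rbar_le_lt_trans _ s); [exact Hu | exact Hs]).
  apply (Cmod_is_series_le (fun k => b (S n + k)%nat * Cpow u (S n + k))%C _
    (fun k => Cmod (b (S n + k)%nat) * s ^ (S n + k))).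
  - apply (is_series_incr_n (V := C_NormedModule) (fun k => b k * Cpow u k)%C); [lia|].
    replace (plus _ _) with (cpseries b u); [apply cpseries_is_series, Hur|].
    change (cpseries b u = cpseries b u - cpartial b u n + cpartial b u n)%C. ring.
  - apply (is_series_incr_n (V := R_NormedModule) (fun k => Cmod (b k) * s ^ k)); [lia|].
    set (T := Series _). set (P := sum_n _ n).
    replace (plus _ _) with T.
    + apply Series_correct, cradius_summable; assumption.
    + change (T = T - P + P). ring.
  - intros k. rewrite Cmod_mult, Cmod_pow. apply Rmult_le_compat_l; [apply Cmod_ge_0|].
    apply pow_incr. split; [apply Cmod_ge_0 | exact Hu].
Qed.

Lemma cpseries_tail_eventually (b : nat -> C) (s eps : R) :
  0 <= s -> Rbar_lt s (cradius b) -> 0 < eps ->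
  exists n0, forall n u, (n0 <= n)%nat -> Cmod u <= s ->
    Cmod (cpseries b u - cpartial b u n)%C < eps.
Proof.
  intros Hs0 Hs Heps.
  pose proof (Series_correct _ (cradius_summable b s Hs0 Hs)) as HS.
  destruct (proj1 (filterlim_locally _ _) HS (mkposreal _ Heps)) as [n0 Hn0].
  exists n0. intros n u Hn Hu. eapply Rle_lt_trans; [apply (cpseries_tail b s); assumption|].
  specialize (Hn0 n Hn). change (Rabs (sum_n (fun k => Cmod (b k) * s ^ k) n - Series (fun k => Cmod (b k) * s ^ k)) < eps) in Hn0.
  apply Rabs_def2 in Hn0. lra.
Qed.

(** The polynomial estimate is applied to long partial sums. Truncating the derivative and the
    series costs B/4 each, where B is the left-hand side, so half of B survives; hence the factor
    2. *)
Lemma cauchy_estimate (b : nat -> C) (u : C) (r : R) :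
  0 < r -> Rbar_lt (Cmod u + r) (cradius b) ->
  exists h, Cmod h = r /\ r * Cmod (cpseries (cderiv b) u) <= 2 * Cmod (cpseries b (u + h)).
Proof.
  intros Hr Hur. pose proof (Cmod_ge_0 u) as Hu0.
  (* If the derivative vanishes, any point of the circle works. Otherwise B > 0 can serve as a
     tolerance. *)
  destruct (Rle_lt_or_eq_dec 0 (Cmod (cpseries (cderiv b) u)) (Cmod_ge_0 _)) as [HB|HB].
  2:{ exists (RtoC r). rewrite <- HB, Cmod_R, Rabs_pos_eq by lra. split; [reflexivity|].
      pose proof (Cmod_ge_0 (cpseries b (u + RtoC r)%C)). lra. }
  set (B := r * Cmod (cpseries (cderiv b) u)).
  assert (HB' : 0 < B) by now apply Rmult_lt_0_compat.
  destruct (cpseries_tail_eventually b (Cmod u + r) (B / 4)) as [n0 Hn0]; [lra | exact Hur | lra|].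
  destruct (cpseries_tail_eventually (cderiv b) (Cmod u + r) (B / 4 / r)) as [n1 Hn1];
    [lra | now rewrite cradius_cderiv | apply Rdiv_lt_0_compat; lra|].
  set (K := (n0 + n1)%nat).
  destruct (cauchy_estimate_poly b u r K Hr) as [h [Hh HK]].
  exists h. split; [exact Hh|].
  assert (Huh : Cmod (u + h)%C <= Cmod u + r) by (rewrite <- Hh; apply Cmod_triangle).
  specialize (Hn0 (S K) (u + h)%C ltac:(unfold K; lia) Huh).
  specialize (Hn1 K u ltac:(unfold K; lia) ltac:(lra)).
  apply (Rmult_lt_compat_r r) in Hn1; [|exact Hr].
  replace (B / 4 / r * r) with (B / 4) in Hn1 by (field; lra).
  pose proof (Cmod_minus_le (cpseries (cderiv b) u) (cpartial (cderiv b) u K)) as H1.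
  pose proof (Cmod_minus_le (cpartial b (u + h) (S K)) (cpseries b (u + h))) as H0.
  rewrite Cmod_minus_sym in H0.
  apply (Rmult_le_compat_r r) in H1; [|lra].
  fold B. assert (B = Cmod (cpseries (cderiv b) u) * r) by (unfold B; ring). lra.
Qed.

(** * Moderate and negligible nets *)

Lemma ev_mono (P Q : R -> Prop) :
  ev P -> (forall e, 0 < e <= 1 -> P e -> Q e) -> ev Q.
Proof.
  intros [e0 [He0 H]] HPQ. exists e0. split; [exact He0|].
  intros e He. apply HPQ; [lra | now apply H].
Qed.

Lemma ev_and (P Q : R -> Prop) : ev P -> ev Q -> ev (fun e => P e /\ Q e).
Proof.
  intros [e0 [He0 H0]] [e1 [He1 H1]]. exists (Rmin e0 e1). split.
  - split; [apply Rmin_glb_lt; lra | eapply Rle_trans; [apply Rmin_l | lra]].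
  - intros e He. pose proof (Rmin_l e0 e1). pose proof (Rmin_r e0 e1).
    split; [apply H0 | apply H1]; lra.
Qed.

(** Turns existence at each fixed parameter into a net. Intermediate points, points on circles and
    maximizing indices are all collected this way. *)
Lemma ev_choice (T : Type) (P : R -> T -> Prop) :
  inhabited T -> ev (fun e => exists x, P e x) -> exists f, ev (fun e => P e (f e)).
Proof.
  intros i H. exists (fun e => epsilon i (P e)).
  apply (ev_mono _ _ H). intros e _ Hx. now apply epsilon_spec.
Qed.

Lemma pow_le_pow_of_le_1 (t : R) (m n : nat) :
  0 < t <= 1 -> (m <= n)%nat -> t ^ n <= t ^ m.
Proof.
  intros Ht Hmn. replace n with (m + (n - m))%nat by lia. rewrite pow_add.
  rewrite <- (Rmult_1_r (t ^ m)) at 2. apply Rmult_le_compat_l; [apply pow_le; lra|].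
  rewrite <- (pow1 (n - m)). apply pow_incr. lra.
Qed.

Lemma inv_pow_le_inv_pow (t : R) (m n : nat) :
  0 < t <= 1 -> (m <= n)%nat -> / t ^ m <= / t ^ n.
Proof.
  intros Ht Hmn. apply Rinv_le_contravar; [apply pow_lt; lra | now apply pow_le_pow_of_le_1].
Qed.

Section Nets.
Variable rho : R -> R.
Hypothesis Hrho : gauge rho.

(* Upper bounds only, meant for nonnegative nets: [Cmoderate rho x] is convertible to
   [moder (fun e => Cmod (x e))], and likewise for [Cnegligible]. *)
Definition moder (f : R -> R) : Prop := exists N : nat, ev (fun e => f e <= / (rho e ^ N)).
Definition negl (f : R -> R) : Prop := forall q : nat, ev (fun e => f e <= rho e ^ q).

Lemma rho_range (e : R) : 0 < e <= 1 -> 0 < rho e <= 1.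
Proof. apply (proj1 Hrho). Qed.

Lemma ev_rho_lt (d : R) : 0 < d -> ev (fun e => rho e < d).
Proof. apply (proj2 Hrho). Qed.

Lemma ev_of_forall (P : R -> Prop) : (forall e, 0 < e <= 1 -> P e) -> ev P.
Proof. intros H. exists 1. split; [lra | exact H]. Qed.

(** Since the gauge tends to 0, one extra power of it absorbs any constant. *)
Lemma ev_rho_mult (k : R) (q : nat) : ev (fun e => k * rho e ^ S q <= rho e ^ q).
Proof.
  apply (ev_mono _ _ (ev_rho_lt (/ (Rabs k + 1)) ltac:(apply Rinv_0_lt_compat; pose proof (Rabs_pos k); lra))).
  intros e He H. pose proof (rho_range e He) as Hr. pose proof (Rabs_pos k). pose proof (Rle_abs k).
  apply (Rmult_lt_compat_l (Rabs k + 1)) in H; [|lra]. rewrite Rinv_r in H by lra.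
  simpl. assert (0 < rho e ^ q) by (apply pow_lt; lra).
  assert (Hk : k * rho e <= 1) by nra.
  rewrite <- Rmult_assoc. rewrite <- (Rmult_1_l (rho e ^ q)) at 2.
  apply Rmult_le_compat_r; lra.
Qed.

Lemma moder_le (f g : R -> R) : moder g -> ev (fun e => f e <= g e) -> moder f.
Proof.
  intros [N H] Hfg. exists N. apply (ev_mono _ _ (ev_and _ _ H Hfg)). intros e _ [H1 H2]. lra.
Qed.

Lemma negl_le (f g : R -> R) : negl g -> ev (fun e => f e <= g e) -> negl f.
Proof.
  intros H Hfg q. apply (ev_mono _ _ (ev_and _ _ (H q) Hfg)). intros e _ [H1 H2]. lra.
Qed.

Lemma negl_moder (f : R -> R) : negl f -> moder f.
Proof.
  intros H. exists 0%nat. apply (ev_mono _ _ (H 0%nat)). intros e _. simpl. rewrite Rinv_1. trivial.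
Qed.

Lemma negl_plus (f g : R -> R) : negl f -> negl g -> negl (fun e => f e + g e).
Proof.
  intros Hf Hg q.
  apply (ev_mono _ _ (ev_and _ _ (ev_rho_mult 2 q) (ev_and _ _ (Hf (S q)) (Hg (S q))))).
  intros e _ [H1 [H2 H3]]. lra.
Qed.

Lemma moder_const (k : R) : moder (fun _ => k).
Proof.
  exists 1%nat. apply (ev_mono _ _ (ev_rho_mult k 0)). intros e He H.
  pose proof (rho_range e He) as Hr. rewrite !pow_1 in *. simpl in H.
  apply (Rmult_le_compat_r (/ rho e)) in H; [|apply Rlt_le, Rinv_0_lt_compat; lra].
  rewrite Rmult_assoc, Rinv_r in H by lra. lra.
Qed.

Lemma moder_inv_pow (N : nat) : moder (fun e => / rho e ^ N).
Proof. exists N. apply ev_of_forall. intros. apply Rle_refl. Qed.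

Lemma moder_pow (N : nat) : moder (fun e => rho e ^ N).
Proof.
  apply (moder_le _ (fun _ => 1)); [apply moder_const|].
  apply ev_of_forall. intros e He. apply (pow_le_pow_of_le_1 _ 0); [now apply rho_range | lia].
Qed.

Lemma moder_mult (f g : R -> R) :
  moder f -> moder g -> (forall e, 0 < e <= 1 -> 0 <= g e) -> moder (fun e => f e * g e).
Proof.
  intros [N Hf] [M Hg] H0. exists (N + M)%nat.
  apply (ev_mono _ _ (ev_and _ _ Hf Hg)). intros e He [H1 H2].
  pose proof (rho_range e He) as Hr. rewrite pow_add, Rinv_mult.
  eapply Rle_trans; [apply Rmult_le_compat_r; [now apply H0 | exact H1]|].
  apply Rmult_le_compat_l; [|exact H2]. apply Rlt_le, Rinv_0_lt_compat, pow_lt. lra.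
Qed.

Lemma negl_mult (f g : R -> R) :
  moder f -> negl g -> (forall e, 0 < e <= 1 -> 0 <= g e) -> negl (fun e => f e * g e).
Proof.
  intros [N Hf] Hg H0 q.
  apply (ev_mono _ _ (ev_and _ _ Hf (Hg (N + q)%nat))). intros e He [H1 H2].
  pose proof (rho_range e He) as Hr. assert (0 < rho e ^ N) by (apply pow_lt; lra).
  eapply Rle_trans; [apply Rmult_le_compat_r; [now apply H0 | exact H1]|].
  replace (rho e ^ q) with (/ rho e ^ N * rho e ^ (N + q)) by (rewrite pow_add; field; lra).
  apply Rmult_le_compat_l; [|exact H2]. apply Rlt_le, Rinv_0_lt_compat. lra.
Qed.

Lemma moder_plus (f g : R -> R) : moder f -> moder g -> moder (fun e => f e + g e).
Proof.
  intros [N Hf] [M Hg].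
  apply (moder_le _ (fun e => 2 * / rho e ^ (N + M))).
  - apply moder_mult; [apply moder_const | apply moder_inv_pow|].
    intros e He. apply Rlt_le, Rinv_0_lt_compat, pow_lt, (rho_range e He).
  - apply (ev_mono _ _ (ev_and _ _ Hf Hg)). intros e He [H1 H2].
    pose proof (inv_pow_le_inv_pow _ N (N + M) (rho_range e He) ltac:(lia)).
    pose proof (inv_pow_le_inv_pow _ M (N + M) (rho_range e He) ltac:(lia)). lra.
Qed.

(** * Strongly equivalent coefficients *)

Lemma sum_n_half_le (x : R) (n : nat) :
  0 <= x -> sum_n (fun k => x * (1 / 2) ^ k) n <= 2 * x.
Proof.
  intros Hx. assert (H : sum_n (fun k => x * (1 / 2) ^ k) n = 2 * x - x * (1 / 2) ^ n).
  { induction n as [|n IH]; [rewrite sum_O; simpl; lra|].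
    rewrite sum_Sn, IH. change plus with Rplus. simpl. lra. }
  rewrite H. assert (0 <= (1 / 2) ^ n) by (apply pow_le; lra). nra.
Qed.

Lemma is_series_half (x : R) : is_series (fun k => x * (1 / 2) ^ k) (2 * x).
Proof.
  replace (2 * x) with (scal x (/ (1 - 1 / 2)) : R).
  - apply (is_series_scal_l (V := R_NormedModule)), is_series_geom. rewrite Rabs_pos_eq; lra.
  - change (x * / (1 - 1 / 2) = 2 * x). field.
Qed.

(** If s <= rho^(-N), strong equivalence with slope N + 1 leaves rho^q rho^n, and rho < 1/2
    eventually. The geometric factor makes the bound summable in n. *)
Lemma strong_equiv_terms (a a' : nat -> R -> C) (s : R -> R) :
  strong_equiv rho a a' -> moder s -> (forall e, 0 < e <= 1 -> 0 <= s e) ->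
  forall q, ev (fun e => forall n, Cmod (a n e - a' n e)%C * s e ^ n <= rho e ^ q * (1 / 2) ^ n).
Proof.
  intros Haa [N Hs] Hs0 q.
  apply (ev_mono _ _ (ev_and _ _ (ev_rho_lt (1 / 2) ltac:(lra)) (ev_and _ _ (Haa (S N) q) Hs))).
  intros e He [Hhalf [H1 H2]] n.
  pose proof (rho_range e He) as Hr. specialize (H1 n).
  change (Cmod (a n e - a' n e)%C <= rho e ^ (n * S N + q)) in H1.
  assert (HN : 0 < rho e ^ N) by (apply pow_lt; lra).
  apply Rle_trans with (rho e ^ (n * S N + q) * (/ rho e ^ N) ^ n).
  { apply Rmult_le_compat; [apply Cmod_ge_0 | apply pow_le, Hs0, He | exact H1|].
    apply pow_incr. split; [apply Hs0, He | exact H2]. }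
  replace (rho e ^ (n * S N + q) * (/ rho e ^ N) ^ n) with (rho e ^ q * rho e ^ n).
  2:{ rewrite Nat.mul_succ_r, !pow_add, (Nat.mul_comm n N), pow_mult, pow_inv.
      field. apply pow_nonzero. lra. }
  apply Rmult_le_compat_l; [apply pow_le; lra | apply pow_incr; lra].
Qed.

Lemma cpartial_strong_equiv (a a' : nat -> R -> C) (u : R -> C) (N : R -> nat) :
  strong_equiv rho a a' -> moder (fun e => Cmod (u e)) ->
  negl (fun e => Cmod (cpartial (fun n => a n e) (u e) (N e) - cpartial (fun n => a' n e) (u e) (N e))%C).
Proof.
  intros Haa Hu q.
  apply (ev_mono _ _ (ev_and _ _ (ev_rho_mult 2 q)
    (strong_equiv_terms _ _ _ Haa Hu (fun e _ => Cmod_ge_0 _) (S q)))).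
  intros e He [H2 H]. pose proof (rho_range e He) as Hr.
  eapply Rle_trans; [|exact H2]. eapply Rle_trans; [|apply (sum_n_half_le _ (N e)), pow_le; lra].
  unfold cpartial.
  match goal with |- Cmod (?x - ?y)%C <= _ => replace (x - y)%C with
    (sum_n (G := C_AbelianMonoid) (fun k => (a k e - a' k e) * Cpow (u e) k)%C (N e)) end.
  - eapply Rle_trans; [apply Cmod_sum_n_le|]. apply sum_n_m_le. intros k.
    rewrite Cmod_mult, Cmod_pow. apply H.
  - clear. induction (N e) as [|n IH]; [rewrite !sum_O; Cring|].
    rewrite !sum_Sn, IH. change plus with Cplus. Cring.
Qed.

(** The strict order of generalized numbers leaves a power of the gauge to spare, which is what
    makes the relation stable under negligible changes. *)
Definition margin (a : nat -> R -> C) (x : R -> R) : Prop :=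
  exists m : nat, ev (fun e => Rbar_lt (x e + rho e ^ m) (cradius (fun n => a n e))).

Lemma ev_lt_cradius (a : nat -> R -> C) (x : R -> R) :
  margin a x -> ev (fun e => Rbar_lt (x e) (cradius (fun n => a n e))).
Proof.
  intros [m H]. apply (ev_mono _ _ H). intros e He. apply Rbar_le_lt_trans.
  pose proof (pow_lt _ m (proj1 (rho_range e He))). simpl. lra.
Qed.

Lemma margin_negl (a : nat -> R -> C) (x y : R -> R) :
  margin a x -> negl (fun e => y e - x e) -> margin a y.
Proof.
  intros [m H] Hd. exists (S m).
  apply (ev_mono _ _ (ev_and _ _ H (ev_and _ _ (Hd (S m)) (ev_rho_mult 2 m)))).
  intros e He [H1 [H2 H3]]. eapply Rbar_le_lt_trans; [|exact H1]. simpl in *. lra.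
Qed.

(** At s = x + rho^m both the old series of moduli and the geometric bound on the differences are
    summable, so the new radius is at least s. Passing to S m restores strictness. *)
Lemma margin_strong_equiv (a a' : nat -> R -> C) (x : R -> R) :
  margin a x -> strong_equiv rho a a' -> moder x -> (forall e, 0 < e <= 1 -> 0 <= x e) ->
  margin a' x.
Proof.
  intros [m H] Haa Hx Hx0. exists (S m).
  assert (Hs : moder (fun e => x e + rho e ^ m)) by (apply moder_plus; [exact Hx | apply moder_pow]).
  assert (Hs0 : forall e, 0 < e <= 1 -> 0 <= x e + rho e ^ m).
  { intros e He. pose proof (Hx0 e He). pose proof (pow_lt _ m (proj1 (rho_range e He))). lra. }
  apply (ev_mono _ _ (ev_and _ _ H (ev_and _ _ (ev_rho_mult 2 m) (strong_equiv_terms _ _ _ Haa Hs Hs0 0)))).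
  intros e He [H1 [H2 H3]]. specialize (Hs0 e He).
  pose proof (pow_lt _ m (proj1 (rho_range e He))).
  apply (Rbar_lt_le_trans _ (x e + rho e ^ m)); [simpl; pose proof (pow_lt _ (S m) (proj1 (rho_range e He))); simpl in *; lra|].
  apply summable_le_cradius; [exact Hs0|].
  apply (ex_series_le (V := R_CompleteNormedModule)) with
    (b := fun n => Cmod (a n e) * (x e + rho e ^ m) ^ n + rho e ^ 0 * (1 / 2) ^ n).
  - intros n. change (Rabs (Cmod (a' n e) * (x e + rho e ^ m) ^ n) <= Cmod (a n e) * (x e + rho e ^ m) ^ n + rho e ^ 0 * (1 / 2) ^ n).
    assert (Hp : 0 <= (x e + rho e ^ m) ^ n) by now apply pow_le.
    rewrite Rabs_pos_eq by (apply Rmult_le_pos; [apply Cmod_ge_0 | exact Hp]).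
    eapply Rle_trans; [|apply Rplus_le_compat_l, (H3 n)].
    rewrite <- Rmult_plus_distr_r. apply Rmult_le_compat_r; [exact Hp|].
    rewrite Cmod_minus_sym. apply Cmod_minus_le.
  - apply (ex_series_plus (V := R_NormedModule)).
    + now apply cradius_summable.
    + eexists. apply is_series_half.
Qed.

Lemma cpseries_strong_equiv (a a' : nat -> R -> C) (u : R -> C) :
  strong_equiv rho a a' -> moder (fun e => Cmod (u e)) -> margin a (fun e => Cmod (u e)) ->
  negl (fun e => Cmod (cpseries (fun n => a n e) (u e) - cpseries (fun n => a' n e) (u e))%C).
Proof.
  intros Haa Hu Hm q.
  pose proof (margin_strong_equiv _ _ _ Hm Haa Hu (fun e _ => Cmod_ge_0 _)) as Hm'.
  apply (ev_mono _ _ (ev_and _ _ (ev_and _ _ (ev_lt_cradius _ _ Hm) (ev_lt_cradius _ _ Hm')) (ev_and _ _ (ev_rho_mult 2 q)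
    (strong_equiv_terms _ _ _ Haa Hu (fun e _ => Cmod_ge_0 _) (S q))))).
  intros e He [[H0 H0'] [H2 H]].
  eapply Rle_trans; [|exact H2].
  apply (Cmod_is_series_le (fun n => (a n e - a' n e) * Cpow (u e) n)%C _ (fun n => rho e ^ S q * (1 / 2) ^ n)).
  - pose proof (is_series_minus (V := C_NormedModule) _ _ _ _ (cpseries_is_series _ _ H0) (cpseries_is_series _ _ H0')) as S2.
    eapply is_series_ext; [|exact S2]. intros n. change (a n e * Cpow (u e) n - a' n e * Cpow (u e) n = (a n e - a' n e) * Cpow (u e) n)%C. ring.
  - apply is_series_half.
  - intros n. rewrite Cmod_mult, Cmod_pow. apply H.
Qed.

(** * Change of representatives in hypersums *)

Lemma finite_argmax (f : nat -> R) (M : nat) :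
  exists k, (k <= M)%nat /\ forall n, (n <= M)%nat -> f n <= f k.
Proof.
  induction M as [|M [k [Hk IH]]].
  - exists 0%nat. split; [lia|]. intros n Hn. replace n with 0%nat by lia. apply Rle_refl.
  - destruct (Rle_or_lt (f k) (f (S M))) as [H|H].
    + exists (S M). split; [lia|]. intros n Hn.
      destruct (Nat.eq_dec n (S M)) as [->|Hne]; [apply Rle_refl|].
      eapply Rle_trans; [apply IH; lia | exact H].
    + exists k. split; [lia|]. intros n Hn.
      destruct (Nat.eq_dec n (S M)) as [->|Hne]; [lra | apply IH; lia].
Qed.

(* Evaluating the hypersums at an [eps]-wise maximizing index makes their moderateness uniform in the
   index; terms are differences of consecutive partial sums. *)
Lemma mod_hypersums_terms (b : nat -> R -> C) (K : nat) :
  mod_hypersums rho b ->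
  exists L : nat, ev (fun e => forall n, INR n <= / rho e ^ K -> Cmod (b n e) <= / rho e ^ L).
Proof.
  intros Hb.
  set (P := fun n e => Cmod (sum_n (G := C_AbelianMonoid) (fun k => b k e) n)).
  assert (Hex : ev (fun e => exists N : nat, INR N <= / rho e ^ K /\
                 forall n, INR n <= / rho e ^ K -> P n e <= P N e)).
  { apply ev_of_forall. intros e He.
    assert (H0 : 0 <= / rho e ^ K) by (apply Rlt_le, Rinv_0_lt_compat, pow_lt, (rho_range e He)).
    destruct (nfloor_ex _ H0) as [M [HM1 HM2]].
    destruct (finite_argmax (fun n => P n e) M) as [N [HN1 HN2]].
    exists N. split; [apply le_INR in HN1; lra|].
    intros n Hn. apply HN2. apply Nat.lt_succ_r, INR_lt. rewrite S_INR. lra. }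
  destruct (ev_choice _ _ (inhabits 0%nat) Hex) as [N HN].
  assert (HNn : hnat rho N).
  { exists K. apply (ev_mono _ _ HN). intros e _ [H _]. rewrite Rabs_pos_eq; [exact H | apply pos_INR]. }
  (* The factor 2 is for a term written as the difference of two partial sums, each bounded by the
     maximal one. *)
  destruct (moder_mult (fun _ => 2) _ (moder_const 2) (Hb N HNn) (fun e _ => Cmod_ge_0 _)) as [L HL].
  exists L. apply (ev_mono _ _ (ev_and _ _ HN HL)). intros e He [[H1 H2] H3] n Hn.
  eapply Rle_trans; [|exact H3]. unfold hypersum. fold (P (N e) e).
  assert (HP : 0 <= P (N e) e) by apply Cmod_ge_0.
  destruct n as [|n].
  - specialize (H2 0%nat Hn). unfold P at 1 in H2. rewrite sum_O in H2. lra.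
  - assert (Hn' : INR n <= / rho e ^ K) by (rewrite S_INR in Hn; lra).
    pose proof (H2 _ Hn). pose proof (H2 _ Hn').
    replace (b (S n) e) with (sum_n (G := C_AbelianMonoid) (fun k => b k e) (S n)
      - sum_n (G := C_AbelianMonoid) (fun k => b k e) n)%C.
    2:{ rewrite sum_Sn. change plus with Cplus. Cring. }
    eapply Rle_trans; [apply Cmod_triangle|]. rewrite Cmod_opp. fold (P (S n) e) (P n e). lra.
Qed.

(** The usual bound n d (s + d)^(n-1), weakened to (s + d)^n / s to avoid a predecessor in the
    exponent. *)
Lemma Cpow_minus_le (u v : C) (s d : R) (n : nat) :
  0 < s -> Cmod v <= s -> Cmod (u - v)%C <= d ->
  Cmod (Cpow u n - Cpow v n)%C <= INR n * d * (s + d) ^ n / s.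
Proof.
  intros Hs Hv Hd. pose proof (Cmod_ge_0 (u - v)%C) as Hd0.
  assert (Hu : Cmod u <= s + d) by (pose proof (Cmod_minus_le u v); lra).
  induction n as [|n IH].
  - simpl Cpow. replace (1 - 1)%C with (RtoC 0) by ring. rewrite Cmod_0. simpl. lra.
  - rewrite !Cpow_S. replace (u * Cpow u n - v * Cpow v n)%C with
      (u * (Cpow u n - Cpow v n) + (u - v) * Cpow v n)%C by ring.
    eapply Rle_trans; [apply Cmod_triangle|]. rewrite !Cmod_mult, Cmod_pow.
    apply Rle_trans with ((s + d) * (INR n * d * (s + d) ^ n / s) + d * (s + d) ^ n).
    + apply Rplus_le_compat; apply Rmult_le_compat; try apply Cmod_ge_0; try assumption.
      * apply pow_le, Cmod_ge_0.
      * apply pow_incr. split; [apply Cmod_ge_0 | lra].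
    + rewrite S_INR. replace ((INR n + 1) * d * (s + d) ^ S n / s) with
       ((s + d) * (INR n * d * (s + d) ^ n / s) + d * (s + d) ^ n * ((s + d) / s)) by (simpl; field; lra).
      apply Rplus_le_compat_l. rewrite <- (Rmult_1_r (d * (s + d) ^ n)) at 1.
      apply Rmult_le_compat_l; [apply Rmult_le_pos; [lra | apply pow_le; lra]|].
      apply Rle_div_r; lra.
Qed.

Lemma one_plus_pow_le_3 (x : R) (n : nat) : 0 <= x -> INR n * x <= 1 -> (1 + x) ^ n <= 3.
Proof.
  intros Hx Hnx. apply Rle_trans with (exp (INR n * x)).
  - clear Hnx. induction n as [|n IH].
    + simpl. rewrite Rmult_0_l, exp_0. apply Rle_refl.
    + rewrite S_INR. replace ((INR n + 1) * x) with (x + INR n * x) by ring. rewrite exp_plus.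
      simpl. pose proof (exp_ineq1_le x). apply Rmult_le_compat; [lra | apply pow_le; lra | lra | exact IH].
  - eapply Rle_trans; [|apply exp_le_3]. destruct Hnx as [H|H]; [left; now apply exp_increasing | rewrite H; apply Rle_refl].
Qed.

(** The condition N d <= s gives (1 + d/s)^n <= 3 for n <= N. Enlarging the radius from s to s + d
    thus costs only a factor 3, and each of the N + 1 terms moves by at most 3 N L d / s. *)
Lemma cpartial_minus_le (b : nat -> C) (u v : C) (s d L : R) (N : nat) :
  0 < s -> Cmod v <= s -> Cmod (u - v)%C <= d -> INR N * d <= s ->
  (forall n, (n <= N)%nat -> Cmod (b n) * s ^ n <= L) ->
  Cmod (cpartial b u N - cpartial b v N)%C <= INR (S N) * (3 * INR N / s * L) * d.
Proof.
  intros Hs Hv Hd HN HL. pose proof (Cmod_ge_0 (u - v)%C) as Hd0.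
  assert (HL0 : 0 <= L).
  { eapply Rle_trans; [|apply (HL 0%nat); lia]. apply Rmult_le_pos; [apply Cmod_ge_0 | apply pow_le; lra]. }
  assert (Hterm : forall n, (n <= N)%nat ->
    Cmod (b n * Cpow u n - b n * Cpow v n)%C <= 3 * INR N / s * L * d).
  { intros n Hn. replace (b n * Cpow u n - b n * Cpow v n)%C with (b n * (Cpow u n - Cpow v n))%C by ring.
    rewrite Cmod_mult.
    eapply Rle_trans; [apply Rmult_le_compat_l; [apply Cmod_ge_0 | apply (Cpow_minus_le u v s d n Hs Hv Hd)]|].
    assert (Hn' : INR n <= INR N) by now apply le_INR.
    pose proof (pos_INR n) as Hn0.
    replace (s + d) with (s * (1 + d / s)) by (field; lra). rewrite Rpow_mult_distr.
    assert (H3 : (1 + d / s) ^ n <= 3).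
    { apply one_plus_pow_le_3; [apply Rle_div_r; lra|].
      replace (INR n * (d / s)) with (INR n * d / s) by (field; lra). apply Rle_div_l; nra. }
    replace (Cmod (b n) * (INR n * d * (s ^ n * (1 + d / s) ^ n) / s))
      with ((Cmod (b n) * s ^ n) * (INR n * (1 + d / s) ^ n * (d / s))) by (field; lra).
    replace (3 * INR N / s * L * d) with (L * (INR N * 3 * (d / s))) by (field; lra).
    assert (0 <= d / s) by (apply Rle_div_r; lra).
    assert (0 <= (1 + d / s) ^ n) by (apply pow_le; lra).
    apply Rmult_le_compat; [apply Rmult_le_pos; [apply Cmod_ge_0 | apply pow_le; lra]| | now apply HL|].
    - apply Rmult_le_pos; [apply Rmult_le_pos|]; assumption.
    - apply Rmult_le_compat_r; [assumption|]. now apply Rmult_le_compat. }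
  assert (Hsum : forall M, (M <= N)%nat ->
    Cmod (cpartial b u M - cpartial b v M)%C <= INR (S M) * (3 * INR N / s * L * d)).
  { unfold cpartial. induction M as [|M IH]; intros HM.
    - rewrite !sum_O. specialize (Hterm 0%nat HM). change (INR 1) with 1. rewrite Rmult_1_l. exact Hterm.
    - rewrite !sum_Sn. specialize (IH ltac:(lia)). pose proof (Hterm _ HM) as Ht.
      change plus with Cplus. set (x := sum_n (fun k => b k * Cpow u k)%C M) in *.
      set (y := sum_n (fun k => b k * Cpow v k)%C M) in *.
      replace (x + b (S M) * Cpow u (S M) - (y + b (S M) * Cpow v (S M)))%C with
        ((x - y) + (b (S M) * Cpow u (S M) - b (S M) * Cpow v (S M)))%C by Cring.
      eapply Rle_trans; [apply Cmod_triangle|]. rewrite (S_INR (S M)), Rmult_plus_distr_r, Rmult_1_l.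
      apply Rplus_le_compat; [exact IH | exact Ht]. }
  eapply Rle_trans; [apply (Hsum N (le_n N))|]. right. ring.
Qed.

Lemma moder_INR (N : R -> nat) : hnat rho N -> moder (fun e => INR (N e)).
Proof.
  intros HN. apply (moder_le _ _ HN), ev_of_forall. intros e _. apply Rle_abs.
Qed.

Lemma cpartial_equiv (a : nat -> R -> C) (u v : R -> C) (N : R -> nat) :
  weakly_moderate rho a -> mod_hypersums rho (fun n e => a n e * Cpow (v e) n)%C ->
  negl (fun e => Cmod (u e - v e)%C) -> hnat rho N ->
  negl (fun e => Cmod (cpartial (fun n => a n e) (u e) (N e) - cpartial (fun n => a n e) (v e) (N e))%C).
Proof.
  intros [Q [R0 Ha]] Hm Huv HN.
  destruct (moder_INR N HN) as [K HK].
  destruct (mod_hypersums_terms _ K Hm) as [L HL].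
  (* The lower bound on the radius keeps 1/s moderate even where [v] is very small. *)
  set (s := fun e => Rmax (Cmod (v e)) (rho e ^ S Q)).
  assert (Hs : forall e, 0 < e <= 1 -> 0 < s e /\ / s e <= / rho e ^ S Q).
  { intros e He. pose proof (rho_range e He) as Hr. pose proof (pow_lt _ (S Q) (proj1 Hr)) as Hp.
    pose proof (Rmax_r (Cmod (v e)) (rho e ^ S Q)) as Hmx. fold (s e) in Hmx.
    split; [lra | now apply Rinv_le_contravar]. }
  set (B := fun e => INR (S (N e)) * (3 * INR (N e) * / s e * (/ rho e ^ L + / rho e ^ R0))).
  assert (HB : moder B).
  { assert (H1 : moder (fun e => / s e)).
    { apply (moder_le _ _ (moder_inv_pow (S Q))), ev_of_forall. intros e He. now apply Hs. }
    unfold B. apply moder_mult.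
    - apply (moder_le _ (fun e => INR (N e) + 1)).
      + apply moder_plus; [now apply moder_INR | apply moder_const].
      + apply ev_of_forall. intros e _. rewrite S_INR. apply Rle_refl.
    - apply moder_mult; [apply moder_mult; [apply moder_mult; [apply moder_const | now apply moder_INR | intros; apply pos_INR]|exact H1|]| |].
      + intros e He. apply Rlt_le, Rinv_0_lt_compat, Hs, He.
      + apply moder_plus; apply moder_inv_pow.
      + intros e He. apply Rplus_le_le_0_compat; apply Rlt_le, Rinv_0_lt_compat, pow_lt, (rho_range e He).
    - intros e He. pose proof (pos_INR (N e)).
      repeat apply Rmult_le_pos; try lra.
      + apply Rlt_le, Rinv_0_lt_compat, Hs, He.
      + apply Rplus_le_le_0_compat; apply Rlt_le, Rinv_0_lt_compat, pow_lt, (rho_range e He). }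
  apply (negl_le _ _ (negl_mult _ _ HB Huv (fun e _ => Cmod_ge_0 _))).
  (* The exponent K + S Q ensures N |u - v| <= rho^(-K) rho^(K+Q+1) = rho^(Q+1) <= s. *)
  apply (ev_mono _ _ (ev_and _ _ (ev_and _ _ Ha HK) (ev_and _ _ HL (Huv (K + S Q)%nat)))).
  intros e He [[H1 H2] [H3 H4]].
  pose proof (rho_range e He) as Hr. destruct (Hs e He) as [Hs0 Hs1].
  unfold B. apply cpartial_minus_le.
  - exact Hs0.
  - apply Rmax_l.
  - apply Rle_refl.
  - apply Rle_trans with (rho e ^ S Q); [|apply Rmax_r].
    replace (rho e ^ S Q) with (/ rho e ^ K * rho e ^ (K + S Q)) by (rewrite pow_add; field; apply pow_nonzero; lra).
    apply Rmult_le_compat; [apply pos_INR | apply Cmod_ge_0 | exact H2 | exact H4].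
  - intros n Hn.
    assert (HpL : 0 < / rho e ^ L) by (apply Rinv_0_lt_compat, pow_lt; lra).
    assert (HpR : 0 < / rho e ^ R0) by (apply Rinv_0_lt_compat, pow_lt; lra).
    unfold s, Rmax. destruct (Rle_dec (Cmod (v e)) (rho e ^ S Q)).
    (* Where s = rho^(Q+1), weak moderateness alone gives |a_n| s^n <= rho^(-R0) rho^n. Where s =
       |v|, the bound on the terms of the hypersums applies. *)
    + apply Rle_trans with (/ rho e ^ (n * Q + R0) * (rho e ^ S Q) ^ n).
      { apply Rmult_le_compat_r; [apply pow_le, pow_le; lra | apply H1]. }
      rewrite <- pow_mult. replace (S Q * n)%nat with (n * Q + n)%nat by lia.
      rewrite !pow_add. assert (Hnq : rho e ^ (n * Q) <> 0) by (apply pow_nonzero; lra).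
      assert (HR0 : rho e ^ R0 <> 0) by (apply pow_nonzero; lra).
      replace (/ (rho e ^ (n * Q) * rho e ^ R0) * (rho e ^ (n * Q) * rho e ^ n)) with (/ rho e ^ R0 * rho e ^ n)
        by (field; split; assumption).
      pose proof (pow_le_pow_of_le_1 _ 0 n Hr ltac:(lia)) as Hp1. simpl in Hp1. nra.
    + specialize (H3 n). rewrite Cmod_mult, Cmod_pow in H3.
      eapply Rle_trans; [apply H3|lra]. apply le_INR in Hn. lra.
Qed.

(** * The set of convergence and its interior *)

Lemma negl_minus_sym (x y : R -> C) :
  negl (fun e => Cmod (x e - y e)%C) -> negl (fun e => Cmod (y e - x e)%C).
Proof.
  intros H. apply (negl_le _ _ H), ev_of_forall. intros e _. right. apply Cmod_minus_sym.
Qed.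

Lemma negl_minus_trans (y x z : R -> C) :
  negl (fun e => Cmod (x e - y e)%C) -> negl (fun e => Cmod (y e - z e)%C) ->
  negl (fun e => Cmod (x e - z e)%C).
Proof.
  intros H1 H2. apply (negl_le _ _ (negl_plus _ _ H1 H2)), ev_of_forall.
  intros e _. apply Cmod_triangle3.
Qed.

Lemma moder_of_equiv (y x : R -> C) :
  moder (fun e => Cmod (y e)) -> negl (fun e => Cmod (x e - y e)%C) -> moder (fun e => Cmod (x e)).
Proof.
  intros H1 H2. apply (moder_le _ _ (moder_plus _ _ H1 (negl_moder _ H2))), ev_of_forall.
  intros e _. apply Cmod_minus_le.
Qed.

(** The truncated exponent n - 1 at n = 0 is harmless because its term carries the factor 0. *)
Lemma Cseries_cderiv (b : nat -> C) (u : C) :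
  Rbar_lt (Cmod u) (cradius b) ->
  Cseries (fun n => mult (RtoC (INR n)) (mult (b n) (Cpow u (n - 1)))) = cpseries (cderiv b) u.
Proof.
  intros Hu. apply Cseries_unique, (is_series_decr_1 (V := C_NormedModule)).
  replace (plus _ _) with (cpseries (cderiv b) u).
  - eapply is_series_ext; [|apply cpseries_is_series; now rewrite cradius_cderiv].
    intros n. unfold cderiv. simpl (S n - 1)%nat. rewrite Nat.sub_0_r.
    change mult with Cmult. Cring.
  - set (l := cpseries _ _). change (l = l + - (RtoC 0 * (b 0%nat * RtoC 1)))%C. ring.
Qed.

(** Already at precision rho^0 = 1 the limit lies within 1 of a hypersum, which is moderate. *)
Lemma hyperseries_limit_moder (b : nat -> R -> C) (l : R -> C) :
  mod_hypersums rho b -> hyperseries_is rho b l -> moder (fun e => Cmod (l e)).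
Proof.
  intros Hm Hl. destruct (Hl 0%nat) as [M [HM H]].
  destruct (H M HM) as [m Hlt].
  { exists (fun _ => 0). split.
    - intros q. apply ev_of_forall. intros e He. rewrite Rabs_R0. apply pow_le, Rlt_le, (rho_range e He).
    - apply ev_of_forall. intros e _. lra. }
  apply (moder_le _ _ (moder_plus _ _ (Hm M HM) (moder_const 1))).
  apply (ev_mono _ _ Hlt). intros e He H1.
  change (rho e ^ 0 - Cmod (hypersum b M e - l e)%C > rho e ^ m) in H1. simpl in H1.
  pose proof (pow_lt _ m (proj1 (rho_range e He))).
  pose proof (Cmod_minus_le (l e) (hypersum b M e)) as H2. rewrite Cmod_minus_sym in H2. lra.
Qed.

Lemma hyperseries_is_equiv (b b' : nat -> R -> C) (l l' : R -> C) :
  hyperseries_is rho b' l' ->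
  (forall N, hnat rho N -> negl (fun e => Cmod (hypersum b N e - hypersum b' N e)%C)) ->
  negl (fun e => Cmod (l e - l' e)%C) ->
  hyperseries_is rho b l.
Proof.
  intros Hb Hs Hl q. destruct (Hb (S q)) as [M [HM H]].
  exists M. split; [exact HM|]. intros N HN HMN.
  destruct (H N HN HMN) as [m Hlt]. exists (S q).
  (* Three errors of size rho^(q+1), plus one more rho^(q+1) to witness the strict inequality, fit
     into rho^q. *)
  apply (ev_mono _ _ (ev_and _ _ (ev_and _ _ Hlt (ev_rho_mult 4 q)) (ev_and _ _ (Hs N HN (S q)) (Hl (S q))))).
  intros e He [[H1 H2] [H3 H4]].
  change (rho e ^ S q - Cmod (hypersum b' N e - l' e)%C > rho e ^ m) in H1.
  change (rho e ^ q - Cmod (hypersum b N e - l e)%C > rho e ^ S q).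
  pose proof (pow_lt _ m (proj1 (rho_range e He))).
  pose proof (Cmod_triangle3 (hypersum b N e) (hypersum b' N e) (l e)) as H5.
  pose proof (Cmod_triangle3 (hypersum b' N e) (l' e) (l e)) as H6.
  rewrite (Cmod_minus_sym (l' e)) in H6. lra.
Qed.

(** Membership in [conv_set] only supplies data at some representatives z', c', a'. They are carried
    over to the given [a] and [c], with the limit evaluated at an arbitrary representative [z1]. *)
Lemma conv_set_any_representative (a : nat -> R -> C) (c z z1 : R -> C) :
  weakly_moderate rho a -> Cmoderate rho c -> conv_set rho a c z -> Cequiv rho z z1 ->
  margin a (fun e => Cmod (z1 e - c e)%C) /\
  hyperseries_is rho (fun n e => mult (a n e) (Cpow (minus (z e) (c e)) n))
    (fun e => cpseries (fun n => a n e) (z1 e - c e)%C) /\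
  moder (fun e => Cmod (cpseries (fun n => a n e) (z1 e - c e)%C)).
Proof.
  intros Ha Hc [Hz [[m Hrad] [z' [c' [a' [Hzz' [Hcc' [Haa' [Hmod [Hser Hder]]]]]]]]]] Hzz1.
  change (negl (fun e => Cmod (z e - z1 e)%C)) in Hzz1.
  change (negl (fun e => Cmod (z e - z' e)%C)) in Hzz'.
  change (negl (fun e => Cmod (c e - c' e)%C)) in Hcc'.
  set (u := fun e => (z e - c e)%C). set (u1 := fun e => (z1 e - c e)%C).
  set (u' := fun e => (z' e - c' e)%C).
  assert (Hu1u : negl (fun e => Cmod (u1 e - u e)%C)).
  { apply (negl_le _ _ Hzz1), ev_of_forall. intros e _. right. rewrite Cmod_minus_sym. f_equal. unfold u, u1. ring. }
  assert (Huu' : negl (fun e => Cmod (u e - u' e)%C)).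
  { apply (negl_le _ _ (negl_plus _ _ Hzz' Hcc')), ev_of_forall. intros e _. unfold u, u'.
    replace (z e - c e - (z' e - c' e))%C with ((z e - z' e) + - (c e - c' e))%C by ring.
    eapply Rle_trans; [apply Cmod_triangle|]. rewrite Cmod_opp. apply Rle_refl. }
  pose proof (negl_minus_trans _ _ _ Hu1u Huu') as Hu1u'.
  assert (Hum : moder (fun e => Cmod (u e))).
  { apply (moder_le _ _ (moder_plus _ _ Hz Hc)), ev_of_forall. intros e _. unfold u.
    eapply Rle_trans; [apply Cmod_triangle|]. rewrite Cmod_opp. apply Rle_refl. }
  assert (Hu1m := moder_of_equiv _ _ Hum Hu1u).
  assert (Hu'm := moder_of_equiv _ _ Hum (negl_minus_sym _ _ Huu')).
  assert (Hdiff : forall x y : R -> C, negl (fun e => Cmod (x e - y e)%C) ->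
     negl (fun e => Cmod (x e) - Cmod (y e))).
  { intros x y H. apply (negl_le _ _ H), ev_of_forall. intros e _.
    pose proof (Cmod_minus_le (x e) (y e)). lra. }
  assert (Hmu : margin a (fun e => Cmod (u e))).
  { exists m. apply (ev_mono _ _ Hrad). intros e He H. apply rad_net_le_cradius; [|exact H].
    pose proof (pow_lt _ m (proj1 (rho_range e He))). pose proof (Cmod_ge_0 (u e)). lra. }
  assert (Hmu1 := margin_negl _ _ _ Hmu (Hdiff _ _ Hu1u)).
  assert (Hmu' : margin a' (fun e => Cmod (u' e))).
  { apply (margin_strong_equiv a); [|exact Haa' | exact Hu'm | intros; apply Cmod_ge_0].
    apply (margin_negl _ _ _ Hmu), Hdiff, negl_minus_sym, Huu'. }
  assert (Hmu1' := margin_negl _ _ _ Hmu' (Hdiff _ _ Hu1u')).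
  assert (HMV : ev (fun e => exists x, Cmod (x - u' e)%C <= Cmod (u1 e - u' e)%C /\
    Cmod (cpseries (fun n => a' n e) (u1 e) - cpseries (fun n => a' n e) (u' e))%C
      <= Cmod (cpseries (cderiv (fun n => a' n e)) x) * Cmod (u1 e - u' e)%C)).
  { apply (ev_mono _ _ (ev_and _ _ (ev_lt_cradius _ _ Hmu1') (ev_lt_cradius _ _ Hmu'))).
    intros e _ [H1 H2]. now apply cpseries_mean_value. }
  destruct (ev_choice _ _ (inhabits (RtoC 0)) HMV) as [x Hx].
  assert (Hxu' : negl (fun e => Cmod (x e - u' e)%C)).
  { apply (negl_le _ _ Hu1u'). apply (ev_mono _ _ Hx). intros e _ [H _]. exact H. }
  assert (Hxm : moder (fun e => Cmod (cpseries (cderiv (fun n => a' n e)) (x e)))).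
  (* The intermediate point [x] is infinitely close to u', so x + c' again represents [z] and
     condition (c) bounds the derivative there. *)
  { assert (Hzh : Cequiv rho z (fun e => x e + c' e)%C).
    { apply (negl_minus_trans z'); [exact Hzz'|].
      apply (negl_le _ _ (negl_minus_sym _ _ Hxu')), ev_of_forall. intros e _. right. f_equal.
      unfold u'. ring. }
    apply (moder_le _ _ (Hder _ Hzh)).
    pose proof (margin_negl _ _ _ Hmu' (Hdiff _ _ Hxu')) as Hmx.
    apply (ev_mono _ _ (ev_lt_cradius _ _ Hmx)). intros e _ H. right. f_equal.
    rewrite <- (Cseries_cderiv (fun n => a' n e) (x e) H).
    change (minus (x e + c' e)%C (c' e)) with (x e + c' e - c' e)%C.
    replace (x e + c' e - c' e)%C with (x e) by ring. reflexivity. }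
  (* First the coefficients change at the fixed point u1, then the point moves from u1 to u'. The
     second change is a moderate derivative times a negligible distance. *)
  assert (HL : negl (fun e => Cmod (cpseries (fun n => a n e) (u1 e) - cpseries (fun n => a' n e) (u' e))%C)).
  { apply (negl_minus_trans (fun e => cpseries (fun n => a' n e) (u1 e))).
    - now apply cpseries_strong_equiv.
    - apply (negl_le _ _ (negl_mult _ _ Hxm Hu1u' (fun e _ => Cmod_ge_0 _))).
      apply (ev_mono _ _ Hx). intros e _ [_ H]. exact H. }
  split; [exact Hmu1|]. split.
  - apply (hyperseries_is_equiv _ _ _ _ Hser); [|exact HL].
    assert (Hc' : forall N : R -> nat, negl (fun e => Cmod (cpartial (fun n => a n e) (u' e) (N e) - cpartial (fun n => a' n e) (u' e) (N e))%C)).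
    { intros N. now apply cpartial_strong_equiv. }
    intros N HN. apply (negl_minus_trans (fun e => cpartial (fun n => a n e) (u' e) (N e))); [|apply Hc'].
    apply (cpartial_equiv a u u'); try assumption.
    intros M HM. apply (moder_of_equiv _ _ (Hmod M HM)), Hc'.
  - refine (moder_of_equiv _ _ _ HL). exact (hyperseries_limit_moder _ _ Hmod Hser).
Qed.

(** * Stability of interior points and moderateness of the derivatives *)

Lemma in_balls_stable (l : list ((R -> C) * (R -> R))) (z : R -> C) :
  (forall p, In p l -> in_ball rho p z) ->
  exists k : nat, forall w, Cmoderate rho w -> ev (fun e => Cmod (w e - z e)%C <= rho e ^ k) ->
    forall p, In p l -> in_ball rho p w.
Proof.
  induction l as [|p l IH]; intros Hl.
  - exists 0%nat. intros w _ _ p [].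
  - destruct IH as [k Hk]; [intros p' Hp'; apply Hl; now right|].
    destruct (Hl p (or_introl eq_refl)) as [_ [m Hm]].
    (* For the head ball, moving by rho^(m+1) consumes only part of its spare rho^m. The sum of the
       exponents serves it and the remaining balls at once. *)
    exists (S m + k)%nat. intros w Hw Hwz p' [<-|Hp'].
    + split; [exact Hw|]. exists (S m).
      apply (ev_mono _ _ (ev_and _ _ (ev_and _ _ Hm Hwz) (ev_rho_mult 2 m))).
      intros e He [[H1 H2] H3].
      change (snd p e - Cmod (z e - fst p e)%C > rho e ^ m) in H1.
      change (snd p e - Cmod (w e - fst p e)%C > rho e ^ S m).
      pose proof (pow_le_pow_of_le_1 _ (S m) (S m + k) (rho_range e He) ltac:(lia)).
      pose proof (Cmod_triangle3 (w e) (z e) (fst p e)). lra.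
    + apply Hk; [exact Hw | | exact Hp'].
      apply (ev_mono _ _ Hwz). intros e He H.
      pose proof (pow_le_pow_of_le_1 _ k (S m + k) (rho_range e He) ltac:(lia)). lra.
Qed.

Lemma sharp_interior_stable (S : (R -> C) -> Prop) (z : R -> C) :
  sharp_interior rho S z ->
  exists k : nat, forall w, Cmoderate rho w -> ev (fun e => Cmod (w e - z e)%C <= rho e ^ k) ->
    sharp_interior rho S w.
Proof.
  intros [_ [l [Hl [Hz HS]]]]. destruct (in_balls_stable l z Hz) as [k Hk].
  exists k. intros w Hw Hwz. split; [exact Hw|]. exists l.
  split; [exact Hl|]. split; [now apply Hk | exact HS].
Qed.

Lemma sharp_interior_subset (S : (R -> C) -> Prop) (z : R -> C) : sharp_interior rho S z -> S z.
Proof. intros [Hz [l [_ [Hl HS]]]]. now apply HS. Qed.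

Lemma cradius_iter_cderiv (k : nat) (b : nat -> C) : cradius (Nat.iter k cderiv b) = cradius b.
Proof. induction k as [|k IH]; [reflexivity|]. simpl. now rewrite cradius_cderiv. Qed.

(** The induction on [k] ranges over all interior points at once, since order k + 1 at one point is
    bounded by order k at another. *)
Lemma cderiv_iter_moder (a : nat -> R -> C) (c : R -> C) (k : nat) :
  weakly_moderate rho a -> Cmoderate rho c ->
  forall z z1, sharp_interior rho (conv_set rho a c) z -> Cequiv rho z z1 ->
  moder (fun e => Cmod (cpseries (Nat.iter k cderiv (fun n => a n e)) (z1 e - c e)%C)).
Proof.
  intros Ha Hc. induction k as [|k IH]; intros z z1 Hz Hzz1.
  - now apply (conv_set_any_representative a c z z1 Ha Hc (sharp_interior_subset _ _ Hz)).
  - destruct (sharp_interior_stable _ _ Hz) as [j Hj].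
    destruct (conv_set_any_representative a c z z1 Ha Hc (sharp_interior_subset _ _ Hz) Hzz1) as [[m Hm] _].
    (* The part m keeps the circle inside the disk of convergence. The part S j, with the negligible
       shift from [z] to [z1], keeps its points within 2 rho^(j+1) <= rho^j of [z]. *)
    set (r := (S j + m)%nat).
    assert (Hex : ev (fun e => exists h, Cmod h = rho e ^ r /\
      rho e ^ r * Cmod (cpseries (Nat.iter (S k) cderiv (fun n => a n e)) (z1 e - c e)%C) <=
      2 * Cmod (cpseries (Nat.iter k cderiv (fun n => a n e)) (z1 e - c e + h)%C))).
    { apply (ev_mono _ _ Hm). intros e He H. apply cauchy_estimate; [apply pow_lt, (rho_range e He)|].
      rewrite cradius_iter_cderiv. eapply Rbar_le_lt_trans; [|exact H].
      apply Rplus_le_compat_l, (pow_le_pow_of_le_1 _ m r (rho_range e He)). unfold r. lia. }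
    destruct (ev_choice _ _ (inhabits (RtoC 0)) Hex) as [h Hh].
    set (w := fun e => (z1 e + h e)%C).
    assert (Hwz : ev (fun e => Cmod (w e - z e)%C <= rho e ^ j)).
    { apply (ev_mono _ _ (ev_and _ _ Hh (ev_and _ _ (Hzz1 (S j)) (ev_rho_mult 2 j)))).
      intros e He [[H1 _] [H2 H3]]. change (Cmod (z e - z1 e)%C <= rho e ^ S j) in H2.
      unfold w. replace (z1 e + h e - z e)%C with (h e + - (z e - z1 e))%C by ring.
      eapply Rle_trans; [apply Cmod_triangle|]. rewrite Cmod_opp, H1.
      pose proof (pow_le_pow_of_le_1 _ (S j) r (rho_range e He) ltac:(unfold r; lia)). lra. }
    assert (Hw : Cmoderate rho w).
    { apply (moder_le _ (fun e => Cmod (z e) + rho e ^ j)).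
      - apply moder_plus; [exact (proj1 Hz) | apply moder_pow].
      - apply (ev_mono _ _ Hwz). intros e _ H. pose proof (Cmod_minus_le (w e) (z e)). lra. }
    assert (Hww : Cequiv rho w w).
    { intros q. apply ev_of_forall. intros e He. change (Cmod (w e - w e)%C <= rho e ^ q).
      replace (w e - w e)%C with (RtoC 0) by ring. rewrite Cmod_0.
      apply pow_le, Rlt_le, (rho_range e He). }
    pose proof (IH w w (Hj w Hw Hwz) Hww) as HD.
    apply (moder_le _ (fun e => / rho e ^ r * 2 * Cmod (cpseries (Nat.iter k cderiv (fun n => a n e)) (w e - c e)%C))).
    + apply moder_mult; [|exact HD | intros; apply Cmod_ge_0].
      apply moder_mult; [apply moder_inv_pow | apply moder_const | intros; lra].
    + apply (ev_mono _ _ Hh). intros e He [_ H].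
      replace (w e - c e)%C with (z1 e - c e + h e)%C by (unfold w; ring).
      pose proof (pow_lt _ r (proj1 (rho_range e He))) as Hr.
      rewrite Rmult_assoc, Rmult_comm. apply Rle_div_r; [exact Hr | now rewrite Rmult_comm].
Qed.

End Nets.

Lemma open_disk_of_convergence (b : nat -> C) (c : C) :
  open (fun w : C => Rbar_lt (Cmod (w - c)%C) (cradius b)).
Proof.
  intros w Hw. destruct (cradius_between _ _ Hw) as [s [Hs1 Hs2]].
  apply locally_C.
  assert (Hd : 0 < s - Cmod (w - c)%C) by lra.
  exists (mkposreal _ Hd). intros y Hy.
  change (Cmod (y - w)%C < s - Cmod (w - c)%C) in Hy.
  apply (Rbar_le_lt_trans _ s); [|exact Hs2].
  pose proof (Cmod_triangle3 y w c). simpl. lra.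
Qed.

Theorem theorem3p1 (rho : R -> R) (a : nat -> R -> C) (c : R -> C) :
  gauge rho ->
  weakly_moderate rho a ->
  Cmoderate rho c ->
  GH_defined_by rho
    (sharp_interior rho (conv_set rho a c))
    (fun z l => hyperseries_is rho (fun n e => mult (a n e) (Cpow (minus (z e) (c e)) n)) l)
    (fun e w => Cseries (fun n => mult (a n e) (Cpow (minus w (c e)) n))).
Proof.
  intros Hrho Ha Hc.
  (* Each domain is the full disk of convergence, possibly empty for some parameters.
     Representatives of interior points eventually lie in it by the margin. *)
  exists (fun e w => Rbar_lt (Cmod (w - c e)%C) (cradius (fun n => a n e))).
  exists (fun e k w => cpseries (Nat.iter k cderiv (fun n => a n e)) (w - c e)%C).
  split; [intros; apply open_disk_of_convergence|].
  split; [reflexivity|].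
  split.
  - intros e _ k w Hw. apply (is_derive_cpseries (Nat.iter k cderiv (fun n => a n e))).
    now rewrite cradius_iter_cderiv.
  - intros z Hz z1 Hzz1.
    destruct (conv_set_any_representative rho Hrho a c z z1 Ha Hc (sharp_interior_subset _ _ _ Hz) Hzz1)
      as [Hm [Hs _]].
    split; [exact (ev_lt_cradius _ Hrho _ _ Hm)|].
    split; [exact Hs|].
    intros k. exact (cderiv_iter_moder rho Hrho a c k Ha Hc z z1 Hz Hzz1).
Qed.
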